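(* Let $S$ be a string and $k\geq 1$. For any minimal $k$-attractor $\Gamma$ of $S$ and any minimum $k$-attractor $\Gamma^*$ of $S$, $|\Gamma|\leq k\cdot|\Gamma^*|$.
   Context: For $S=S[1..n]$, a set $\Gamma\subseteq[1..n]$ is a $k$-attractor of $S$ if every substring $S[i..j]$ with $i\leq j<i+k$ has an occurrence $S[i'..j']=S[i..j]$ with $j''\in[i'..j']$ for some $j''\in\Gamma$. It is minimal if it is a $k$-attractor and $\Gamma\setminus\{j\}$ is not a $k$-attractor for any $j\in\Gamma$; it is minimum if it has smallest cardinality among all $k$-attractors. *)

(* Defs.v *)
From mathcomp Require Import all_boot.

Set Implicit Arguments.
Unset Strict Implicit.
Unset Printing Implicit Defensive.

(* Positions of a string of length n are indexed by 'I_n, i.e. from 0. *)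

(* S[i..j], both ends included; only meaningful for i <= j. *)
Definition substring (T : eqType) (n : nat) (S : n.-tuple T) (i j : 'I_n) : seq T :=
  take (j - i).+1 (drop i S).

(* The occurrence S[i'..j'] automatically satisfies i' <= j', since it contains g. *)
Definition attractor (T : eqType) (n : nat) (k : nat) (S : n.-tuple T)
    (G : {set 'I_n}) : Prop :=
  forall i j : 'I_n, i <= j < i + k ->
    exists i' j' : 'I_n,
      substring S i' j' = substring S i j /\
      exists2 g : 'I_n, g \in G & i' <= g <= j'.

Definition minimal_attractor (T : eqType) (n : nat) (k : nat) (S : n.-tuple T)
    (G : {set 'I_n}) : Prop :=
  attractor k S G /\ forall g : 'I_n, g \in G -> ~ attractor k S (G :\ g).

Definition minimum_attractor (T : eqType) (n : nat) (k : nat) (S : n.-tuple T)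
    (G : {set 'I_n}) : Prop :=
  attractor k S G /\ forall G' : {set 'I_n}, attractor k S G' -> #|G| <= #|G'|.

(* Main.v *)
Require Import Defs.
From mathcomp Require Import all_boot zify.
Set Implicit Arguments.
Unset Strict Implicit.
Unset Printing Implicit Defensive.

(* Proof idea. Let a "window" be a factor of length k of S followed by blanks, and
   call a suffix recurring if it occurs elsewhere. Every window, except the
   truncated ones that show a recurring suffix, is a word of length at most k
   that has to be hit, so the number of windows is at most
   k |Gstar| + #(recurring suffixes shorter than k): a window is determined by an
   element hitting it and the offset of that element. It remains to show that a
   minimal k-attractor G satisfies
     |G| + #(recurring suffixes shorter than k) <= #(windows of length k).
   This goes by induction on k. For k = l + 1 choose a minimal l-attractor G2
   inside G. The other elements of G have private words of length exactly l + 1,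
   which G2 does not hit, while every l-window extends to an (l+1)-window that is
   truncated or hit by G2. This proves the claim unless the suffix of length l
   recurs and all these estimates are equalities. In that case the extensions of
   the l-windows are unique on both sides, so the l-windows form a graph that is a
   disjoint union of one path, ending with the truncated windows, and of cycles.
   The elements of G2 are points of this graph, exactly l - 1 points are not hit,
   and some e in G \ G2 has a private word consisting of the suffix of length l
   and one more letter. If replacing an element of G2 by e gave an l-attractor, it
   would hit that private word, against tightness; so every element of G2 has a
   private word that avoids e. Following the graph from the window reached by this
   extra letter, one finds l points that are not hit: if that window lies on the
   path, by counting hits in a periodic run cut at the residue class of e; if it
   lies on a cycle, because otherwise everything outside the cycle and the last
   windows would be hit by elements whose private words are single letters, which
   is impossible where S leaves the cycle. *)

(** * Private intervals on a periodic line *)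

(* Memberships, residues and local functions are atoms that only slow [lia] down. *)
Ltac nlia :=
  repeat match goal with
    | H : context [modn] |- _ => clear H
    | H : is_true (_ \in _) |- _ => clear H
    | H : is_true (_ \notin _) |- _ => clear H
    | H : forall _, _ |- _ => clear H
  end;
  repeat match goal with
    | x := context [modn] |- _ => clearbody x
    | x := _ : nat |- _ => subst x
    | x := _ |- _ => clearbody x
  end; lia.

Lemma modn_gap q x y : x = y %[mod q] -> x < y -> x + q <= y.
Proof.
move=> e l; have : q %| y - x by rewrite -eqn_mod_dvd ?(ltnW l) //; apply/eqP.
by move/dvdn_leq => h; have := h (ltac:(lia)); lia.
Qed.

Lemma modn_addr q x y d : x = y %[mod q] -> x + d = y + d %[mod q].
Proof. by move=> e; apply/eqP; rewrite eqn_modDr; apply/eqP. Qed.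

Lemma residue_in_window q x f : f < q -> exists2 z, x <= z < x + q & z %% q = f.
Proof.
move=> fq; exists (x + (f + (q - x %% q)) %% q).
  by have := ltn_pmod (f + (q - x %% q)) (leq_ltn_trans (leq0n _) fq); lia.
have q0 := leq_ltn_trans (leq0n _) fq.
rewrite modnDmr -modnDml addnCA subnKC; last exact: ltnW (ltn_pmod _ _).
by rewrite modnDr modn_small.
Qed.

Section Line.
(** Points [h] of [s] lie on the line [1..N] and [[lo h, hi h]] is the place of a private word of
    [h]. On a line of period [q] the word recurs under shifts by multiples of [q], hence [alone]. *)
Variables (q N : nat) (lo hi : nat -> nat) (s F : seq nat).
Hypothesis uniq_s : uniq s.
Hypothesis in_line : forall h : nat, h \in s -> [/\ 0 < lo h, lo h <= h, h <= hi h & hi h <= N].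
Hypothesis alone : forall h h' x : nat, h \in s -> h' \in s -> 0 < x ->
  x = lo h %[mod q] -> x + (hi h - lo h) <= N -> x <= h' <= x + (hi h - lo h) -> h' = h.
Hypothesis uniq_F : uniq F.
Hypothesis ltF : forall f : nat, f \in F -> f < q.
Hypothesis F_nonempty : exists f : nat, f \in F.
Hypothesis avoidF : forall h z : nat, h \in s -> lo h <= z <= hi h -> z %% q \notin F.

Let conf (h : nat) := has (fun h' : nat => (h < h') && (h == h' %[mod q])) s.
Let mu := N.+1 %% q.

Let q_gt0 : 0 < q.
Proof. by have [f /ltF] := F_nonempty; nlia. Qed.

(** Shifting one of two conflicting intervals onto the other must leave the line, so [lo h' <= d]
    and [N < hi h + d]. Together the two intervals keep all classes of [1..hi h] out of [F]; as [F]
    is nonempty, [hi h < q], which identifies [mu] as [N.+1 - d]. *)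
Lemma conflict_spec (h : nat) : h \in s -> conf h -> [/\ h < mu, mu <= hi h & hi h < q].
Proof.
move=> hs /hasP [/= h' h's /andP [lt /eqP e]].
have [l1 l2 l3 l4] := in_line hs; have [k1 k2 k3 k4] := in_line h's.
have [d dE] : exists d, h' = h + d by exists (h' - h); nlia.
have ed : forall z, z + d = z %[mod q].
  by move=> z; apply/eqP; rewrite -{2}[z]addn0 eqn_modDl -(eqn_modDl h) addn0 -dE; apply/eqP.
have low : lo h' <= d.
  rewrite leqNgt; apply/negP => hd.
  have : h = h'; last by nlia.
  apply: (@alone h' h (lo h' - d)) => //; try nlia.
  by rewrite -[LHS]ed subnK // ltnW.
have hiN : N < hi h + d.
  rewrite ltnNge; apply/negP => hd.
  have : h' = h; last by nlia.
  by apply: (@alone h h' (lo h + d)) => //; first [exact: ed | nlia | idtac].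
have noF z : 0 < z <= hi h -> z %% q \notin F.
  move=> zb; have [zh|zh] := leqP (lo h) z; first by apply: (avoidF hs); nlia.
  by rewrite -ed; apply: (avoidF h's); nlia.
have hq : hi h < q.
  rewrite ltnNge; apply/negP => hq.
  have [f fF] := F_nonempty.
  have [z zb ez] := residue_in_window 1 (ltF fF).
  by have := noF z; rewrite ez fF; move=> /(_ ltac:(nlia)).
have muE : mu = N.+1 - d.
  have small : N.+1 - d < q by nlia.
  by rewrite -[RHS](modn_small small) -ed subnK //; nlia.
by rewrite muE; split=> //; nlia.
Qed.

(** A conflicting point leaves its residue to the larger point of its class and takes the class just
    past the end of the line. *)
Let psi h := if conf h then mu else h %% q.

Lemma psi_uniq : uniq (map psi s).
Proof.
rewrite map_inj_in_uniq // => h k hs ks; rewrite /psi.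
(* [mu] lies in the interval of [h0], so a point [k0] of class [mu] would fall into this interval or
   a shifted copy of it. *)
have own_mu (h0 k0 : nat) : h0 \in s -> k0 \in s -> conf h0 -> k0 %% q = mu -> False.
  move=> h0s k0s c e; have [c1 c2 c3] := conflict_spec h0s c.
  have [l1 l2 l3 l4] := in_line h0s; have [k1 k2 k3 k4] := in_line k0s.
  have muq : mu %% q = mu by rewrite modn_small //; nlia.
  have ek : mu = k0 %[mod q] by rewrite muq e.
  have neq : k0 = h0 -> False by move=> e0; move: e; rewrite e0 modn_small; nlia.
  have [lt|ge] := ltnP mu k0.
    have gap : k0 + q <= N.+1 by apply: modn_gap; [rewrite e|nlia].
    apply: neq; apply: (@alone h0 k0 (lo h0 + (k0 - mu))) => //; try nlia.
    apply/eqP; rewrite -(eqn_modDr mu) (_ : _ + _ + mu = lo h0 + k0); last by nlia.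
    by rewrite eqn_modDl; apply/eqP; rewrite ek.
  have : k0 = mu; last by move=> e0; apply: neq; apply: (@alone h0 k0 (lo h0)) => //; nlia.
  case: (ltngtP mu k0) => // l; first by nlia.
  by have := modn_gap (esym ek) l; nlia.
case ch: (conf h); case ck: (conf k) => // e; last 1 first.
- case: (ltngtP h k) => // l.
    by move/negP: ch; case; apply/hasP; exists k; rewrite // l e /=.
  by move/negP: ck; case; apply/hasP; exists h; rewrite // l e /=.
- have [c1 c2 c3] := conflict_spec hs ch; have [d1 d2 d3] := conflict_spec ks ck.
  have [l1 l2 l3 l4] := in_line hs; have [k1 k2 k3 k4] := in_line ks.
  case: (ltngtP h k) => // l.
    by apply/esym; apply: (@alone h k (lo h)) => //; nlia.
  by apply: (@alone k h (lo k)) => //; nlia.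
- by case: (@own_mu h k).
- by case: (@own_mu k h).
Qed.

Lemma psi_avoid (h : nat) : h \in s -> psi h \notin F /\ psi h < q.
Proof.
move=> hs; have [l1 l2 l3 l4] := in_line hs; rewrite /psi; case: ifP => c; last first.
  by split; [apply: (avoidF hs); nlia | rewrite ltn_pmod].
have [c1 c2 c3] := conflict_spec hs c; split; last by nlia.
by have := @avoidF h mu hs ltac:(nlia); rewrite modn_small //; nlia.
Qed.

Let all_classes := F ++ map psi s.

Let uniq_all : uniq all_classes.
Proof.
rewrite cat_uniq uniq_F psi_uniq andbT /=; apply/hasPn => _ /mapP [h hs ->].
by case: (psi_avoid hs).
Qed.

Let all_lt x : x \in all_classes -> x < q.
Proof.
rewrite mem_cat => /orP [/ltF //|/mapP [h hs ->]].
by case: (psi_avoid hs).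
Qed.

Lemma line_size : size s + size F <= q.
Proof.
have := uniq_leq_size uniq_all (s2 := iota 0 q).
rewrite size_cat size_map size_iota addnC; apply => x /all_lt.
by rewrite mem_iota.
Qed.

Lemma line_size_lt x : x < q -> x \notin all_classes -> size s + size F < q.
Proof.
move=> xq nx; have := @uniq_leq_size _ (x :: all_classes) (iota 0 q).
rewrite /= nx uniq_all size_cat size_map size_iota addnC; apply=> // y.
by rewrite inE mem_iota => /orP [/eqP ->|/all_lt].
Qed.

Lemma line_conflict x : x < q -> x \notin F -> x \notin map (modn^~ q) s ->
  size s + size F < q \/ exists h h' : nat, [/\ h \in s, h' \in s, h < h' & h = h' %[mod q]].
Proof.
move=> xq xF xs; have [/hasP [h hs /hasP [h' h's /andP [l /eqP e]]]|/hasPn nc] := boolP (has conf s).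
  by right; exists h, h'.
left; apply: (@line_size_lt x) => //; rewrite mem_cat negb_or xF.
apply: contra xs => /mapP [h hs ->]; rewrite /psi (negbTE (nc _ hs)).
exact: map_f.
Qed.

(** [psi] departs from the residue only by the value [mu], so it fills at most one of the two
    classes. *)
Lemma line_two_missing x y : x < q -> y < q -> x != y -> x \notin F -> y \notin F ->
  x \notin map (modn^~ q) s -> y \notin map (modn^~ q) s -> size s + size F < q.
Proof.
move=> xq yq xy xF yF xs ys.
have only_mu z : z \notin F -> z \notin map (modn^~ q) s -> z \in all_classes -> z = mu.
  move=> zF zs; rewrite mem_cat (negbTE zF) => /mapP [h hs]; rewrite /psi.
  by case: ifP => // _ e; case/negP: zs; rewrite e; apply: map_f.
have [xa|] := boolP (x \in all_classes); last exact: line_size_lt.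
have [ya|] := boolP (y \in all_classes); last exact: line_size_lt.
by case/eqP: xy; rewrite (only_mu x) // (only_mu y).
Qed.
End Line.

(** * Hits on a labelled graph made of a path and cycles *)

Lemma periodic_on (A : Type) (f : nat -> A) q N :
  (forall z, 0 < z -> z + q <= N -> f (z + q) = f z) ->
  forall x y, 0 < x <= N -> 0 < y <= N -> x = y %[mod q] -> f x = f y.
Proof.
move=> per.
have main c x : 0 < x -> x + c * q <= N -> f (x + c * q) = f x.
  elim: c => [|c IH] x0 xN; first by rewrite mul0n addn0.
  rewrite mulSn addnCA addnC per ?IH //; nlia.
have half x y : 0 < x -> y <= N -> x <= y -> x = y %[mod q] -> f x = f y.
  move=> x0 yN xy /esym /eqP; rewrite eqn_mod_dvd // => /dvdnP [c cE].
  have -> : y = x + c * q by nlia.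
  by rewrite main //; nlia.
move=> x y xb yb e; case: (leqP x y) => l; first by apply: half => //; nlia.
by apply/esym; apply: half; [nlia|nlia|nlia|exact: esym].
Qed.

Section Core.
Variables (X : finType) (A : eqType) (bot : X) (nx : X -> X) (lab : X -> A).
Variables (D H : {set X}) (l : nat) (s v : X) (j : nat).
Variables (sg : X -> X) (m o : X -> nat).
(* Points are l-windows, [nx] moves one position to the right, and [bot] is the
   end of the string. [s] is the window of the recurring suffix, [v] the window
   that follows it at the occurrence next to e, and [j] the offset of e there.
   The private word of a hit point [h] has length [m h], starts at [sg h] and
   contains [h] at offset [o h]; [not_left] and [not_right] say that it does not
   occur around e. *)
Local Notation wk i x := (iter i nx x).
Hypothesis nx_bot : nx bot = bot.
Hypothesis bot_D : bot \notin D.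
Hypothesis nx_D : forall x, x \in D -> nx x != bot -> nx x \in D.
Hypothesis nx_inj : forall x y, x \in D -> y \in D -> nx x = nx y -> nx x != bot -> x = y.
Hypothesis H_D : H \subset D.
Hypothesis s_D : s \in D.
Hypothesis v_D : v \in D.
Hypothesis s_walk : forall i, i < l -> wk i s != bot.
Hypothesis s_end : wk l s = bot.
Hypothesis v_walk : forall i, i < l -> wk i v != bot.
Hypothesis lab_vs : forall i, i.+1 < l -> lab (wk i v) = lab (wk i.+1 s).
Hypothesis lab_pred_v : forall x, x \in D -> nx x = v -> lab x != lab s.
Hypothesis only_end : forall x, x \in D -> nx x = bot -> wk l.-1 s = x.
Hypothesis j_le : j <= l.
Hypothesis sg_D : forall h, h \in H -> sg h \in D.
Hypothesis o_m : forall h, h \in H -> o h < m h <= l.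
Hypothesis sg_o : forall h, h \in H -> wk (o h) (sg h) = h.
Hypothesis sg_walk : forall h i, h \in H -> i < m h -> wk i (sg h) != bot.
Hypothesis private : forall h x, h \in H -> x \in D ->
  (forall i, i < m h -> wk i x != bot /\ lab (wk i x) = lab (wk i (sg h))) ->
  forall i, i < m h -> wk i x \in H -> wk i x = h.
Hypothesis not_left : forall h x, h \in H -> x \in D -> j < l ->
  (forall i, i < m h -> wk i x != bot /\ lab (wk i x) = lab (wk i (sg h))) ->
  forall i, i < m h -> wk i x != wk j s.
Hypothesis not_right : forall h a, h \in H -> a < j <= a + m h ->
  ~ (forall i, i < m h -> wk (a + i) v != bot /\ lab (wk (a + i) v) = lab (wk i (sg h))).
Hypothesis v_hit : exists2 i, i < l & wk i v \in H.
Hypothesis escape : forall C : {set X}, v \in C -> (forall x, x \in C -> x \in D /\ nx x \in C) ->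
  exists u v', [/\ u \in C, v' \notin C, v' \in D, (forall i, i < l -> wk i v' != bot) &
    forall i, i.+1 < l -> lab (wk i v') = lab (wk i.+1 u)].

Lemma walk_bot i : wk i bot = bot.
Proof. by elim: i => //= i ->. Qed.

Lemma walk_le i i' x : wk i x != bot -> i' <= i -> wk i' x != bot.
Proof.
move=> h le; apply: contra h => /eqP e; rewrite -(subnK le) iterD e.
by rewrite walk_bot.
Qed.

Lemma walk_D i x : x \in D -> wk i x != bot -> wk i x \in D.
Proof.
move=> xD; elim: i => //= i IH h; apply: nx_D => //; apply: IH.
by apply: contra h => /eqP ->; rewrite nx_bot.
Qed.

Lemma walk_inj i x y : x \in D -> y \in D -> wk i x = wk i y -> wk i x != bot -> x = y.
Proof.
move=> xD yD; elim: i => //= i IH e h.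
have hx : wk i x != bot by apply: contra h => /eqP ->; rewrite nx_bot.
have hy : wk i y != bot by apply: contra h => /eqP hy; rewrite e hy nx_bot.
by apply: IH => //; apply: nx_inj => //; apply: walk_D.
Qed.

Lemma walk_back a b x y : x \in D -> y \in D -> wk a x = wk b y -> wk b y != bot ->
  a <= b -> x = wk (b - a) y.
Proof.
move=> xD yD e h le; have hb : wk (b - a) y != bot := walk_le h (leq_subr a b).
have e' : wk a x = wk a (wk (b - a) y) by rewrite -iterD subnKC.
by apply: walk_inj e' _ => //; rewrite ?e //; apply: walk_D.
Qed.

Lemma H_in_D h : h \in H -> h \in D.
Proof. exact: (subsetP H_D). Qed.

Lemma H_neq_bot h : h \in H -> h != bot.
Proof. by move/H_in_D; apply: contraTneq => ->. Qed.

Lemma D_neq_bot x : x \in D -> x != bot.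
Proof. by apply: contraTneq => ->. Qed.

Lemma own_only h i : h \in H -> i < m h -> wk i (sg h) \in H -> wk i (sg h) = h.
Proof.
by move=> hH; apply: private => // [|k km]; [apply: sg_D | split=> //; apply: sg_walk].
Qed.

Lemma cycle_never_ends x a i : x \in D -> 0 < a -> wk a x = x -> wk i x != bot.
Proof.
move=> xD a0 e; have main c : wk (c * a) x = x.
  by elim: c => //= c IH; rewrite mulSn iterD IH.
by apply: (@walk_le (i * a)); rewrite ?main ?D_neq_bot //; nia.
Qed.

Lemma unhit_size (r : seq X) : uniq r -> {subset r <= D :\: H} -> size r <= #|D :\: H|.
Proof.
move=> ur sub; rewrite cardE; apply: uniq_leq_size => // x /sub.
by rewrite mem_enum.
Qed.

(** * The path case: the walk from [v] reaches [s] *)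

Section PathCase.
Variable p : nat.
Hypothesis reach : wk p v = s.
(** The run [zt 1, ..., zt N] starts at [v], passes [s = zt q] and ends just before [bot]. By
    [lab_vs] its labels have period [q]. *)
Let q := p.+1.
Let N := p + l.
Let zt z := wk z.-1 v.

Let ztS z : p < z -> zt z = wk (z - q) s.
Proof. by move=> h; rewrite /zt -reach -iterD; congr (iter _ nx v); nlia. Qed.

Let zt_neq z : z <= N -> zt z != bot.
Proof.
move=> zN; have [h|h] := leqP z p.
  by apply: (@walk_le p); rewrite ?reach ?D_neq_bot //; nlia.
rewrite ztS // s_walk //; nlia.
Qed.

Let no_cycle a : 0 < a -> wk a v != v.
Proof.
move=> a0; apply/eqP => e; have := cycle_never_ends (l + p) v_D a0 e.
by rewrite iterD reach s_end eqxx.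
Qed.

Let zt_inj a b : 0 < a <= N -> 0 < b <= N -> zt a = zt b -> a = b.
Proof.
have half x y : 0 < x <= N -> 0 < y <= N -> x <= y -> zt x = zt y -> x = y.
  move=> xb yb xy e; have := walk_back v_D v_D e (zt_neq _) _.
  move=> /(_ ltac:(nlia) ltac:(nlia)) e1.
  case: (ltngtP x y) => // lt; last by nlia.
  by have := @no_cycle (y.-1 - x.-1) ltac:(nlia); rewrite -e1 eqxx.
move=> ab bb e; case: (leqP a b) => c; first exact: half.
by apply/esym; apply: half => //; nlia.
Qed.

Let zt_lab x y : 0 < x <= N -> 0 < y <= N -> x = y %[mod q] -> lab (zt x) = lab (zt y).
Proof.
apply: (@periodic_on _ (fun z => lab (zt z))) => z z0 zN.
rewrite ztS; last by rewrite /q; nlia.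
rewrite addnK /zt lab_vs; last by rewrite /N /q in zN *; nlia.
by rewrite prednK.
Qed.

(** The hit points whose private word starts inside the run; the words of the others begin before
    [v]. *)
Let hs := [seq z <- iota 1 N | (zt z \in H) && (o (zt z) < z)].
Let lo z := z - o (zt z).
Let hi z := lo z + (m (zt z)).-1.

Let hsP (z : nat) : z \in hs -> [/\ 0 < z <= N, zt z \in H, o (zt z) < z & zt (lo z) = sg (zt z)].
Proof.
rewrite mem_filter mem_iota => /andP [/andP [hH oz] zb]; split=> //.
rewrite /zt /lo; apply/esym.
have -> : (z - o (zt z)).-1 = z.-1 - o (zt z) by nlia.
by apply: walk_back; rewrite ?sg_D ?sg_o // ?H_neq_bot //; nlia.
Qed.

Let sg_zt (z i : nat) : z \in hs -> i < m (zt z) -> wk i (sg (zt z)) = zt (lo z + i) /\ lo z + i <= N.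
Proof.
move=> zs im; have [zb hH oz e] := hsP zs.
have e1 : wk i (sg (zt z)) = zt (lo z + i).
  by rewrite -e /zt -iterD; congr (iter _ nx v); rewrite /lo; nlia.
split=> //; rewrite leqNgt; apply/negP => big.
have := sg_walk hH im; rewrite e1 /zt.
have -> : (lo z + i).-1 = (lo z + i).-1 - (l + p) + (l + p) by rewrite /N in big *; nlia.
by rewrite iterD (iterD l) reach s_end walk_bot eqxx.
Qed.

Let in_line (z : nat) : z \in hs -> [/\ 0 < lo z, lo z <= z, z <= hi z & hi z <= N].
Proof.
move=> zs; have [zb hH oz e] := hsP zs; have om := o_m hH.
have [_ h] := @sg_zt z (m (zt z)).-1 zs ltac:(nlia).
by split; rewrite /hi /lo //; rewrite /hi /lo in h *; nlia.
Qed.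

Let shifted (z x : nat) : z \in hs -> 0 < x -> x = lo z %[mod q] -> x + (hi z - lo z) <= N ->
  forall i, i < m (zt z) -> zt (x + i) != bot /\ lab (zt (x + i)) = lab (wk i (sg (zt z))).
Proof.
move=> zs x0 xm xN i im; have [-> h] := sg_zt zs im; have [h1 h2 h3 h4] := in_line zs.
have iN : x + i <= N by rewrite /hi in xN; nlia.
split; first exact: zt_neq.
by apply: zt_lab; [nlia|nlia|exact: modn_addr].
Qed.

Let alone (h h' x : nat) : h \in hs -> h' \in hs -> 0 < x -> x = lo h %[mod q] ->
  x + (hi h - lo h) <= N -> x <= h' <= x + (hi h - lo h) -> h' = h.
Proof.
move=> hh hh' x0 xm xN xh; have [hb hH ho he] := hsP hh; have [hb' hH' ho' he'] := hsP hh'.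
have om := o_m hH; have hl : hi h - lo h = (m (zt h)).-1 by rewrite /hi addKn.
have zE i : wk i (zt x) = zt (x + i) by rewrite /zt -iterD; congr (iter _ nx v); nlia.
have xD : zt x \in D by apply: walk_D => //; apply: zt_neq; nlia.
rewrite hl in xh; have := @private (zt h) (zt x) hH xD _ (h' - x) _ _; rewrite zE subnKC; last by nlia.
move=> P; apply: zt_inj => //; apply: P => //; last by nlia.
by move=> i im; rewrite zE; apply: shifted.
Qed.

Let right_bad (h x : nat) : h \in hs -> 0 < x -> x = lo h %[mod q] -> x + (hi h - lo h) <= N ->
  x <= j <= x + (hi h - lo h) -> False.
Proof.
move=> hh x0 xm xN xj; have [hb hH ho he] := hsP hh; have om := o_m hH.
apply: (@not_right (zt h) x.-1 hH); first by rewrite /hi in xj; nlia.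
move=> i im; have := shifted hh x0 xm xN im; rewrite /zt.
by have -> : (x + i).-1 = x.-1 + i by nlia.
Qed.

(** A word meeting the class of [j] could be shifted along the period onto position [j], against
    [not_right], or onto [j + q], which is [wk j s], against [not_left]. *)
Let avoid (h z : nat) : h \in hs -> lo h <= z <= hi h -> z %% q \notin [:: j %% q].
Proof.
move=> hh zb; rewrite inE; apply/eqP => zm.
have [hb hH ho he] := hsP hh; have om := o_m hH; have [h1 h2 h3 h4] := in_line hh.
have [lt|ge] := ltnP (hi h) j.
(* the word lies left of j: shift its last position of class j to j *)
  have [z' z'b z'm] : exists2 z', (lo h <= z' <= hi h) && (hi h < z' + q) & z' %% q = j %% q.
    have := divn_eq (hi h - z) q; have := ltn_pmod (hi h - z) (ltn0Sn p).
    move: ((hi h - z) %% p.+1) ((hi h - z) %/ q) => r d rq e.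
    by exists (z + d * q); [nlia | rewrite addnC modnMDl].
  have sh : j + lo h = lo h + (j - z') + z' by nlia.
  apply: (@right_bad h (lo h + (j - z'))) => //; try (nlia).
  apply/eqP; rewrite -(eqn_modDr z') -sh addnC eqn_modDl; apply/eqP.
  by rewrite z'm.
have [le|gt] := leqP (lo h) j.
  by apply: (@right_bad h (lo h)) => //; nlia.
(* The word lies right of [j]: its first position of class [j] is shifted down to [j + q]. *)
have zj : j + q <= z by apply: modn_gap; [rewrite zm|nlia].
have jl : j < l by rewrite /N /q in h4 zj; nlia.
have [z' z'b z'm] := @residue_in_window q (lo h) (j %% q) (ltn_pmod j (ltn0Sn p)).
have z'z : z' <= z.
  rewrite leqNgt; apply/negP => c; have : z = z' %[mod q] by rewrite z'm zm.
  by move=> /modn_gap /(_ ltac:(nlia)); rewrite /q; nlia.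
have jz' : j + q <= z' by apply: modn_gap; [rewrite z'm|nlia].
pose x := lo h - (z' - (j + q)).
have x0 : 0 < x by rewrite /x; nlia.
have xm : x = lo h %[mod q].
  apply/eqP; rewrite -(eqn_modDr z') (_ : x + z' = lo h + (j + q)); last by rewrite /x; nlia.
  by rewrite eqn_modDl modnDr z'm.
have xN : x + (hi h - lo h) <= N by rewrite /x; nlia.
have zE i : wk i (zt x) = zt (x + i) by rewrite /zt -iterD; congr (iter _ nx v); nlia.
have xD : zt x \in D by apply: walk_D => //; apply: zt_neq; nlia.
have match_x i : i < m (zt h) -> wk i (zt x) != bot /\ lab (wk i (zt x)) = lab (wk i (sg (zt h))).
  by move=> im; rewrite zE; apply: shifted.
have := @not_left (zt h) (zt x) hH xD jl match_x (j + q - x).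
rewrite zE subnKC; last by rewrite /x; nlia.
have zj' : zt (j + q) = wk j s by rewrite ztS ?addnK //; nlia.
rewrite zj' eqxx; have hE : hi h = lo h + (m (zt h)).-1 by [].
by move=> F; have : false by apply: F; nlia.
Qed.

(** Of the [p + l] points of the run at most [p] are hit by words starting inside it and at most one
    is late. If one is late, the predecessor [pi] of [v] is an unhit point off the run and makes up
    for it. *)
Lemma path_case : l <= #|D :\: H|.
Proof.
have sz : size hs <= p.
  have := @line_size q N lo hi hs [:: j %% q]; rewrite /= addn1 => L.
  rewrite -ltnS; apply: L => //.
  - by rewrite filter_uniq ?iota_uniq.
  - by move=> f; rewrite inE => /eqP ->; rewrite ltn_pmod.
  - by exists (j %% q); rewrite inE.
pose late := [seq z <- iota 1 N | (zt z \in H) && (z <= o (zt z))].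
pose free := [seq z <- iota 1 N | zt z \notin H].
have sumN : size hs + size late + size free = N.
  rewrite !size_filter -[RHS](size_iota 1 N) -(count_predC (fun z => zt z \in H)).
  congr (_ + _); rewrite -count_predUI [X in _ + X](_ : _ = 0); last first.
    by apply/eqP; rewrite -leqn0 leqNgt -has_count; apply/hasPn => z _ /=; nlia.
  by rewrite addn0; apply: eq_count => z /=; nlia.
have free_uniq : uniq (map zt free).
  rewrite map_inj_in_uniq ?filter_uniq ?iota_uniq // => a b.
  by rewrite !mem_filter !mem_iota => /andP [_ ab] /andP [_ bb]; apply: zt_inj; nlia.
have free_sub : {subset map zt free <= D :\: H}.
  move=> _ /mapP [z zf ->]; move: zf; rewrite mem_filter mem_iota inE => /andP [-> zb] /=.
  by apply: walk_D => //; apply: zt_neq; nlia.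
have lateP (z : nat) : z \in late -> exists pi, [/\ pi \in D, nx pi = v &
    exists2 i, i.+1 < m (zt z) & wk i (sg (zt z)) = pi].
  rewrite mem_filter mem_iota => /andP [/andP [hH oz] zb].
  have om := o_m hH; exists (wk (o (zt z) - z) (sg (zt z))); split.
  - by apply: walk_D; [exact: sg_D | apply: sg_walk => //; nlia].
  - rewrite -iterS; apply/esym.
    have := @walk_back z.-1 (o (zt z)) v (sg (zt z)) v_D (sg_D hH).
    rewrite sg_o // => /(_ erefl (H_neq_bot hH) ltac:(nlia)) ->.
    by congr (iter _ nx _); nlia.
  - by exists (o (zt z) - z) => //; nlia.
(* A word that enters through [v] and reaches [zt b] passes all earlier points of the run, among
   them the hit point [zt a]. *)
have late1 : size late <= 1.
  rewrite leqNgt; apply/negP => big.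
  have lu : uniq late by rewrite filter_uniq ?iota_uniq.
  have half (a b : nat) : a \in late -> b \in late -> a < b -> False.
    rewrite !mem_filter !mem_iota => /andP [/andP [aH oa] ab] /andP [/andP [bH ob] bb] lt.
    have om := o_m bH.
    have e : wk (o (zt b) - (b - a)) (sg (zt b)) = zt a.
      have := @walk_back (b - a) (o (zt b)) (zt a) (sg (zt b)) (H_in_D aH) (sg_D bH).
      rewrite sg_o // => -> //; first by rewrite /zt -iterD; congr (iter _ nx v); nlia.
        exact: H_neq_bot.
      by nlia.
    have := @own_only (zt b) (o (zt b) - (b - a)) bH ltac:(nlia); rewrite e => /(_ aH).
    by move/zt_inj; nlia.
  case E: late big half lu => [|a [|b r]] //= _ half; rewrite inE negb_or => /andP [/andP [ab _] _].
  case: (ltngtP a b) => lt.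
  - by apply: (half a b); rewrite ?inE ?eqxx ?orbT.
  - by apply: (half b a); rewrite ?inE ?eqxx ?orbT.
  - by rewrite lt eqxx in ab.
have [late0|] := posnP (size late).
  have := unhit_size free_uniq free_sub; rewrite size_map /N in sumN *; nlia.
case E: late => [//|z0 r] _; have z0l : z0 \in late by rewrite E inE eqxx.
have [pi [piD piv [i im ie]]] := lateP _ z0l.
have z0H : zt z0 \in H by move: z0l; rewrite mem_filter => /andP [/andP []].
have pi_run z : 0 < z <= N -> zt z != pi.
  move=> zb; apply/eqP => e; have := @no_cycle z ltac:(nlia).
  by rewrite -{2}piv -e /zt -iterS prednK ?eqxx //; nlia.
have piH : pi \notin H.
  apply/negP => piH; have := @own_only (zt z0) i z0H ltac:(nlia); rewrite ie => /(_ piH) e.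
  have z0b : 0 < z0 <= N by move: z0l; rewrite mem_filter mem_iota => /andP [_ b]; nlia.
  by have := pi_run _ z0b; rewrite e eqxx.
have := @unhit_size (pi :: map zt free); rewrite /= free_uniq andbT size_map.
have -> : pi \notin [seq zt i | i <- free].
  apply/mapP => -[z zf e]; move: zf; rewrite mem_filter mem_iota => /andP [_ zb].
  by have := @pi_run z ltac:(nlia); rewrite e eqxx.
move=> /(_ isT) K; rewrite /N in sumN.
suff : (size free).+1 <= #|D :\: H| by nlia.
by apply: K => x; rewrite inE => /orP [/eqP ->|/free_sub //]; rewrite inE piH.
Qed.
End PathCase.

(** * The cycle case: the walk from [v] never reaches [s] *)

Section CycleCase.
Hypothesis no_reach : forall p, wk p v != s.
Hypothesis few_unhit : #|D :\: H| < l.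

(** By [only_end] a walk enters [bot] only through the last point of the walk from [s]; stepping
    back from there, it would have passed [s]. *)
Let v_neq_bot i : wk i v != bot.
Proof.
elim: i => [|i IH]; first exact: D_neq_bot.
apply/eqP => e; have [lt|ge] := ltnP i.+1 l.
  by have := v_walk lt; rewrite e eqxx.
have e1 := only_end (walk_D v_D IH) e.
have e2 := walk_back s_D v_D e1 IH ltac:(nlia).
by have := no_reach (i - l.-1); rewrite -e2 eqxx.
Qed.

Lemma cycle_length : exists2 L, 0 < L & wk L v = v /\ (forall i, 0 < i < L -> wk i v != v).
Proof.
have ex : exists L, (0 < L) && (wk L v == v).
  pose f (i : 'I_#|X|.+1) := wk i v.
  have /injectivePn [a [b ab e]] : ~~ injectiveb f.
    by apply/injectiveP => /leq_card; rewrite card_ord ltnn.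
  wlog lt : a b ab e / a < b.
    case: (ltngtP a b) => c W; [exact: (W a b)|exact: (W b a (ltac:(by rewrite eq_sym)))|].
    by case/eqP: ab; apply: val_inj.
  exists (b - a); rewrite subn_gt0 lt; apply/eqP/esym.
  exact: walk_back v_D v_D e (v_neq_bot _) (ltnW lt).
case: (ex_minnP ex) => L /andP [L0 /eqP e] mn; exists L => //; split=> // i /andP [i0 iL].
by apply/eqP => ei; have := mn i; rewrite i0 ei eqxx => /(_ isT); rewrite leqNgt iL.
Qed.

Section Period.
Variable L : nat.
Hypothesis L_gt0 : 0 < L.
Hypothesis walk_L : wk L v = v.
Hypothesis L_min : forall i, 0 < i < L -> wk i v != v.

(* The cycle through v, indexed so that cz 1 = v. *)
Let cz z := wk (z + L.-1) v.

Let czS z : nx (cz z) = cz z.+1.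
Proof. by []. Qed.

Let cz_walk i z : wk i (cz z) = cz (z + i).
Proof. by rewrite /cz -iterD; congr (iter _ nx v); nlia. Qed.

Let cz_v z : 0 < z -> cz z = wk z.-1 v.
Proof. by move=> z0; rewrite /cz -[in RHS]walk_L -iterD; congr (iter _ nx v); nlia. Qed.

Let cz_mod x y : x = y %[mod L] -> cz x = cz y.
Proof.
have main c z : cz (c * L + z) = cz z.
  elim: c => // c IH; rewrite -[RHS]IH {1}/cz.
  have -> : c.+1 * L + z + L.-1 = c * L + z + L.-1 + L by nlia.
  by rewrite iterD walk_L.
by move=> e; rewrite (divn_eq x L) (divn_eq y L) !main e.
Qed.

Let cz_neq z : cz z != bot.
Proof. exact: v_neq_bot. Qed.

Let cz_D z : cz z \in D.
Proof. by apply: walk_D. Qed.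

Let cz_inj x y : cz x = cz y -> x = y %[mod L].
Proof.
have half a b : a < L -> b < L -> a <= b -> cz a = cz b -> a = b.
  move=> aL bL ab e; case: (ltngtP a b) => // lt; last by nlia.
  have := walk_back v_D v_D e (cz_neq _) ltac:(nlia) => e1.
  by have := @L_min (b + L.-1 - (a + L.-1)) ltac:(nlia); rewrite -e1 eqxx.
move=> e.
have {}e : cz (x %% L) = cz (y %% L).
  by rewrite (@cz_mod (x %% L) x) ?modn_mod // (@cz_mod (y %% L) y) ?modn_mod.
have xL := ltn_pmod x L_gt0; have yL := ltn_pmod y L_gt0.
by case: (leqP (x %% L) (y %% L)) => c; [apply: half | apply/esym/half => //; apply: ltnW].
Qed.

Let C := [set cz z | z : 'I_L].

Let CP x : reflect (exists z, x = cz z) (x \in C).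
Proof.
apply: (iffP imsetP) => [[z _ ->]|[z ->]]; first by exists z.
exists (Ordinal (ltn_pmod z L_gt0)) => //=.
by apply: cz_mod; rewrite modn_mod.
Qed.

Let cz_C z : cz z \in C.
Proof. by apply/CP; exists z. Qed.

Let pred_C x : x \in D -> nx x \in C -> x \in C.
Proof.
move=> xD /CP [z e]; apply/CP; exists (z + L.-1).
apply: nx_inj => //; first by rewrite e czS; apply: cz_mod; rewrite -addnS prednK // modnDr.
by rewrite e.
Qed.

Let term_C t : wk t s \notin C.
Proof.
apply/negP => /CP [z e]; have [lt|ge] := leqP t l.
  by have := s_end; rewrite -(subnK lt) iterD e cz_walk => e1; have := cz_neq (z + (l - t)); rewrite e1 eqxx.
by have := cz_neq z; rewrite -e -(subnK (ltnW ge)) iterD s_end walk_bot eqxx.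
Qed.

Let term_D t : t < l -> wk t s \in D.
Proof. by move=> tl; apply: walk_D => //; apply: s_walk. Qed.

Let term_lt t : wk t s != bot -> t < l.
Proof.
by move=> h; rewrite ltnNge; apply: contra h => ge; rewrite -(subnK ge) iterD s_end walk_bot.
Qed.

Let s_not_on_cycle a : 0 < a -> wk a s != s.
Proof.
by move=> a0; apply/eqP => e; have := cycle_never_ends l s_D a0 e; rewrite s_end eqxx.
Qed.

Let term_inj a b : a < l -> b < l -> wk a s = wk b s -> a = b.
Proof.
have half x y : x < l -> y < l -> x <= y -> wk x s = wk y s -> x = y.
  move=> xl yl xy e; case: (ltngtP x y) => // lt; last by nlia.
  have e1 := walk_back s_D s_D e (s_walk yl) xy.
  by have := @s_not_on_cycle (y - x) ltac:(nlia); rewrite -e1 eqxx.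
move=> al bl e; case: (leqP a b) => c; first exact: half.
by apply/esym; apply: half => //; nlia.
Qed.

Let lab_term z : 0 < z < l -> lab (wk z s) = lab (cz z).
Proof.
move=> zb; rewrite cz_v ?lab_vs; [|nlia|nlia].
by rewrite prednK //; nlia.
Qed.

(** The path from [s] to the end carries the labels of the cycle and serves as a line of period [L].
    [ts] collects its hit points whose words start after [s]; the forbidden classes [F] are those
    hit on the cycle. *)
Let ts := [seq z <- iota 1 l.-1 | (wk z s \in H) && (o (wk z s) < z)].
Let F := [seq z <- iota 0 L | cz z \in H].
Let lo z := z - o (wk z s).
Let hi z := lo z + (m (wk z s)).-1.

Let tsP (z : nat) : z \in ts -> [/\ 0 < z < l, wk z s \in H, o (wk z s) < z & wk (lo z) s = sg (wk z s)].
Proof.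
rewrite mem_filter mem_iota => /andP [/andP [hH oz] zb]; split=> //; first by nlia.
apply/esym; apply: walk_back; rewrite ?sg_D ?sg_o // ?H_neq_bot //; nlia.
Qed.

Let sg_t (z i : nat) : z \in ts -> i < m (wk z s) -> wk i (sg (wk z s)) = wk (lo z + i) s /\ lo z + i < l.
Proof.
move=> zs im; have [zb hH oz e] := tsP zs.
have e1 : wk i (sg (wk z s)) = wk (lo z + i) s by rewrite -e -iterD addnC.
by split=> //; apply: term_lt; rewrite -e1; apply: sg_walk.
Qed.

Let in_line (z : nat) : z \in ts -> [/\ 0 < lo z, lo z <= z, z <= hi z & hi z <= l.-1].
Proof.
move=> zs; have [zb hH oz e] := tsP zs; have om := o_m hH.
have [_ h] := @sg_t z (m (wk z s)).-1 zs ltac:(nlia).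
by split; rewrite /hi /lo //; rewrite /hi /lo in h *; nlia.
Qed.

Let alone (h h' x : nat) : h \in ts -> h' \in ts -> 0 < x -> x = lo h %[mod L] ->
  x + (hi h - lo h) <= l.-1 -> x <= h' <= x + (hi h - lo h) -> h' = h.
Proof.
move=> hh hh' x0 xm; have -> : hi h - lo h = (m (wk h s)).-1 by rewrite /hi addKn.
move=> xN xh; have [hb hH ho he] := tsP hh; have [hb' hH' ho' he'] := tsP hh'.
have om := o_m hH; have xD : wk x s \in D by apply: term_D; nlia.
have := @private (wk h s) (wk x s) hH xD _ (h' - x) _ _; rewrite -iterD subnK; last by nlia.
have [h1 h2 h3 h4] := in_line hh.
move=> P; apply: term_inj; [nlia|nlia|]; apply: P => //; last by nlia.
move=> i im; have [-> h5] := sg_t hh im; rewrite -iterD addnC.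
split; first by apply: s_walk; nlia.
rewrite !lab_term; [|nlia|nlia]; congr (lab _).
by apply: cz_mod; apply: modn_addr.
Qed.

Let inF z : (z %% L \in F) = (cz z \in H).
Proof.
rewrite mem_filter mem_iota /= add0n ltn_pmod // andbT.
by rewrite (@cz_mod (z %% L) z) // modn_mod.
Qed.

Let ltF (f : nat) : f \in F -> f < L.
Proof. by rewrite mem_filter mem_iota => /andP [_]. Qed.

Let F_nonempty : exists f : nat, f \in F.
Proof.
have [i il iH] := v_hit; exists (i.+1 %% L).
by rewrite inF cz_v.
Qed.

(** The word can also be read on the cycle from [cz (lo h)], where it meets the hit point [cz z];
    privacy would put [wk h s] on the cycle. *)
Let avoidF (h z : nat) : h \in ts -> lo h <= z <= hi h -> z %% L \notin F.
Proof.
move=> hh zb; rewrite inF; apply/negP => zH.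
have [hb hH ho he] := tsP hh; have om := o_m hH; have [h1 h2 h3 h4] := in_line hh.
have hE : hi h = lo h + (m (wk h s)).-1 by [].
have := @private (wk h s) (cz (lo h)) hH (cz_D _) _ (z - lo h) _ _; rewrite cz_walk subnKC; last by nlia.
move=> P; have e : cz z = wk h s.
  apply: P => //; last by nlia.
  move=> i im; have [-> h5] := sg_t hh im; rewrite cz_walk lab_term //; nlia.
by have := term_C h; rewrite -e cz_C.
Qed.

Let uniq_ts : uniq ts.
Proof. by rewrite filter_uniq ?iota_uniq. Qed.
Let uniq_F : uniq F.
Proof. by rewrite filter_uniq ?iota_uniq. Qed.

Let ts_size : size ts + size F <= L :=
  line_size uniq_ts in_line alone uniq_F ltF F_nonempty avoidF.
Let ts_conflict := line_conflict uniq_ts in_line alone uniq_F ltF F_nonempty avoidF.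
Let ts_two_missing := line_two_missing uniq_ts in_line alone uniq_F ltF F_nonempty avoidF.

Let late := [seq z <- iota 0 l | (wk z s \in H) && (z <= o (wk z s))].

Let lateP (z : nat) : z \in late -> [/\ z < l, wk z s \in H &
  forall t, t <= z -> o (wk z s) - (z - t) < m (wk z s) /\ wk (o (wk z s) - (z - t)) (sg (wk z s)) = wk t s].
Proof.
rewrite mem_filter mem_iota => /andP [/andP [hH oz] zb]; split=> // t tz.
have om := o_m hH; split; first by nlia.
apply/esym; apply: walk_back; rewrite ?sg_o ?sg_D // ?H_neq_bot //; try nlia.
  by apply: term_D; nlia.
by rewrite -iterD subnK.
Qed.

Let late_first (z t : nat) : z \in late -> t < z -> wk t s \notin H.
Proof.
move=> zl tz; have [zb zH sub] := lateP zl; apply/negP => tH.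
have [i im] := sub t (ltnW tz).
have := own_only zH i; rewrite im => /(_ tH) /term_inj; nlia.
Qed.

Let late_size : size late <= 1.
Proof.
have lu : uniq late by rewrite filter_uniq ?iota_uniq.
have half (a b : nat) : a \in late -> b \in late -> a < b -> False.
  move=> al bl lt; have [_ aH _] := lateP al.
  by have := late_first bl lt; rewrite aH.
case E: late half lu => [|a [|b r]] //= half; rewrite inE negb_or => /andP [/andP [ab _] _].
case: (ltngtP a b) => lt.
- by case: (half a b); rewrite ?inE ?eqxx ?orbT.
- by case: (half b a); rewrite ?inE ?eqxx ?orbT.
- by rewrite lt eqxx in ab.
Qed.

Let unhit_known := [seq cz z | z <- iota 0 L & cz z \notin H] ++
                   [seq wk z s | z <- iota 0 l & wk z s \notin H].

Let unhit_known_uniq : uniq unhit_known.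
Proof.
rewrite cat_uniq; apply/and3P; split.
- rewrite map_inj_in_uniq ?filter_uniq ?iota_uniq // => a b.
  rewrite !mem_filter !mem_iota => /andP [_ aL] /andP [_ bL] /cz_inj.
  by rewrite !modn_small.
- apply/hasPn => _ /mapP [z zf ->]; apply/negP => /mapP [y _ e].
  by have := term_C z; rewrite e cz_C.
- rewrite map_inj_in_uniq ?filter_uniq ?iota_uniq // => a b.
  by rewrite !mem_filter !mem_iota => /andP [_ aL] /andP [_ bL]; apply: term_inj.
Qed.

Let unhit_known_sub : {subset unhit_known <= D :\: H}.
Proof.
move=> x; rewrite mem_cat => /orP [] /mapP [z]; rewrite mem_filter mem_iota => /andP [zH zb] ->.
  by rewrite inE zH cz_D.
by rewrite inE zH term_D.
Qed.

Let unhit_known_size : size unhit_known + (size ts + size F + size late) = L + l.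
Proof.
have l0 : 0 < l by nlia.
have eF : size F + size [seq cz z | z <- iota 0 L & cz z \notin H] = L.
  rewrite size_map !size_filter -[RHS](size_iota 0 L).
  exact: (count_predC (fun z => cz z \in H)).
have eT : size ts + size late = count (fun z => wk z s \in H) (iota 0 l).
  have -> : ts = [seq z <- iota 0 l | (wk z s \in H) && (o (wk z s) < z)].
    by rewrite -(prednK l0) /= ltn0 andbF.
  rewrite !size_filter -count_predUI [X in _ + X](_ : _ = 0); last first.
    by apply/eqP; rewrite -leqn0 leqNgt -has_count; apply/hasPn => z _ /=; case: (_ \in H) => //=; nlia.
  by rewrite addn0; apply: eq_count => z /=; case: (_ \in H) => //=; nlia.
have := count_predC (fun z => wk z s \in H) (iota 0 l); rewrite size_iota => eS.
have e2 : size [seq wk z s | z <- iota 0 l & wk z s \notin H] =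
          count (predC (fun z => wk z s \in H)) (iota 0 l) by rewrite size_map size_filter.
rewrite /unhit_known size_cat; move: eF eT eS e2.
by move: (size F) (size ts) (size late) (size _) (size _) (count _ _) (count _ _); nlia.
Qed.

(** The cycle and the path from [s] have [L + l] points, of which at most [L] and one late point are
    hit; fewer than [l] unhit points force equality. *)
Let ts_full : size ts + size F = L.
Proof.
have := unhit_size unhit_known_uniq unhit_known_sub; have := few_unhit.
have := unhit_known_size; have := late_size; have := ts_size.
by move: (size unhit_known) (size ts) (size F) (size late) #|_|; nlia.
Qed.

(** The cycle and the path from [s] already contain at least [l - 1] unhit points. *)
Let outside_hit x : x \in D -> x \notin C -> (forall t, t < l -> x != wk t s) -> x \in H.
Proof.
move=> xD xC xT; apply/negPn/negP => xH.
have xn : x \notin unhit_known.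
  rewrite mem_cat negb_or; apply/andP; split; apply/mapP => -[z].
    by move=> _ e; rewrite e cz_C in xC.
  by rewrite mem_filter mem_iota => /andP [_ zb] e; have := xT z zb; rewrite e eqxx.
have := @unhit_size (x :: unhit_known); rewrite /= xn unhit_known_uniq => /(_ isT) K.
have : (size unhit_known).+1 <= #|D :\: H|.
  by apply: K => y; rewrite inE => /orP [/eqP ->|/unhit_known_sub //]; rewrite inE xH xD.
have := unhit_known_size; have := late_size; have := ts_full; have := few_unhit.
by move: (size unhit_known) (size ts) (size F) (size late) #|_|; nlia.
Qed.

(** * A late point on the path from [s] *)

Section LateElement.
Variable i0 : nat.
Hypothesis i0_late : i0 \in late.

Let ts_gt (z : nat) : z \in ts -> i0 < z.
Proof.
move=> zs; have [zb zH oz _] := tsP zs; rewrite ltnNge; apply/negP => le.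
have [lt|ge] := ltnP z i0; first by have := late_first i0_late lt; rewrite zH.
have e : z = i0 by nlia.
by move: i0_late; rewrite mem_filter -e => /andP [/andP [_]]; rewrite leqNgt oz.
Qed.

Let j_gt : i0 < j.
Proof.
have [i0l hH sub] := lateP i0_late; rewrite ltnNge; apply/negP => le.
have [im e] := sub j le; have := @not_left (wk i0 s) (sg (wk i0 s)) hH (sg_D hH) ltac:(nlia) _ _ im.
rewrite e eqxx => P; suff : false by [].
by apply: P => i ib; split=> //; apply: sg_walk.
Qed.

Let term_j : j < l -> wk j s \notin H.
Proof.
move=> jl; apply/negP => hH; have om := o_m hH.
have := @not_left (wk j s) (sg (wk j s)) hH (sg_D hH) jl _ (o (wk j s)) ltac:(nlia).
rewrite sg_o // eqxx => P; suff : false by [].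
by apply: P => i ib; split=> //; apply: sg_walk.
Qed.

Let missing x := [&& x < L, x \notin F & x \notin map (modn^~ L) ts].

(** [ts] and [F] together count [L], so a missing class forces two points of [ts] into one class, at
    distance at least [L] and beyond [i0]. *)
Let conflict x : missing x -> L + i0 + 1 < l.
Proof.
case/and3P => xL xF xt; case: (ts_conflict xL xF xt) => [|[h [h' [hs hs' lt e]]]].
  by rewrite ts_full ltnn.
have g := ts_gt hs; have [b _ _ _] := tsP hs'.
by have := modn_gap e lt; nlia.
Qed.

(** [cz j] is hit, as no point of [ts] has its class. By [not_right] its word starts before [v] and
    so passes [cz i0], which is hit for the same reason. *)
Let none_missing_absurd : l <= L.+1 -> (i0 = 0 -> l <= L) -> (forall x, ~~ missing x) -> False.
Proof.
move=> lL i0L none.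
have classP z : (cz z \in H) || (z %% L \in map (modn^~ L) ts).
  have := none (z %% L); rewrite /missing inF ltn_pmod //=.
  by case: (cz z \in H) => //=; rewrite negbK.
have jg := j_gt; have [i0l hH sub] := lateP i0_late.
have fH : cz j \in H.
  case/orP: (classP j) => // /mapP [z zs e]; have [zb zH _ _] := tsP zs; have zg := ts_gt zs.
  case: (ltngtP z j) => c.
  - by have := modn_gap (esym e) c; have [/i0L|] := posnP i0; nlia.
  - by have := modn_gap e c; nlia.
  - by have := @term_j ltac:(nlia); rewrite -c zH.
have om := o_m fH; have czj : cz j = wk j.-1 v by rewrite cz_v //; nlia.
have [lt|ge] := ltnP (o (cz j)) j.
  have e : sg (cz j) = wk (j.-1 - o (cz j)) v.
    by apply: walk_back; rewrite ?sg_D ?sg_o //; nlia.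
  apply: (@not_right (cz j) (j.-1 - o (cz j)) fH); first by nlia.
  by move=> i im; rewrite e -iterD addnC; split.
have cH : cz i0 \in H.
  case/orP: (classP i0) => // /mapP [z zs e]; have [zb zH _ _] := tsP zs.
  by have := modn_gap e (ts_gt zs); have [/i0L|] := posnP i0; nlia.
have e : cz i0 = wk (o (cz j) - (j - i0)) (sg (cz j)).
  apply: walk_back; rewrite ?sg_o ?sg_D ?cz_walk ?subnKC //; nlia.
have := @own_only (cz j) (o (cz j) - (j - i0)) fH ltac:(nlia); rewrite -e => /(_ cH) /cz_inj ee.
by have := modn_gap ee jg; have [/i0L|] := posnP i0; nlia.
Qed.

Let long_cycle_absurd : l <= L -> False.
Proof.
move=> lL; apply: none_missing_absurd => // [|x]; first by nlia.
by apply/negP => /conflict; nlia.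
Qed.

(** * A cycle shorter than [l], left by the string at [v'] *)

Section ShortCycle.
Hypothesis L_lt : L < l.
Variables (u v' : X) (zu : nat).
Hypothesis u_eq : u = cz zu.
Hypothesis v'_C : v' \notin C.
Hypothesis v'_D : v' \in D.
Hypothesis v'_walk : forall i, i < l -> wk i v' != bot.
Hypothesis lab_v' : forall i, i.+1 < l -> lab (wk i v') = lab (wk i.+1 u).

Let lab_y i : i.+1 < l -> lab (wk i v') = lab (cz (zu.+1 + i)).
Proof. by move=> il; rewrite lab_v' // u_eq cz_walk addSnnS. Qed.

Let y_D i : i < l -> wk i v' \in D.
Proof. by move=> il; apply: walk_D => //; apply: v'_walk. Qed.

Let y_C i : i < l -> wk i v' \notin C.
Proof.
elim: i => // i IH il; apply/negP => /= yC.
by have := IH (ltnW il); rewrite pred_C // y_D // ltnW.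
Qed.

Let v'_term t : 0 < t -> v' != wk t s.
Proof.
move=> t0; apply/eqP => e; have [tl|tl] := leqP t l.
  have := @v'_walk (l - t) ltac:(nlia); rewrite e -iterD subnK // s_end eqxx => //.
have := D_neq_bot v'_D; rewrite e -(subnK (ltnW tl)) iterD s_end walk_bot eqxx //.
Qed.

Let y_term i t : i < l -> t < l -> (forall k, k <= i -> wk k v' != s) -> wk i v' != wk t s.
Proof.
move=> il tl ns; apply/eqP => e; have [ti|it] := leqP t i.
  have := ns (i - t) (leq_subr _ _).
  by rewrite -(walk_back s_D v'_D (esym e) (v'_walk il) ti) eqxx.
have := @v'_term (t - i) ltac:(nlia).
by rewrite -(walk_back v'_D s_D e (s_walk tl) (ltnW it)) eqxx.
Qed.

(** Until it meets [s], the walk from [v'] stays off the cycle and off the path from [s], so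
    [outside_hit] applies. *)
Let y_hit i : i < l -> (forall k, k <= i -> wk k v' != s) -> wk i v' \in H.
Proof.
move=> il ns; apply: outside_hit; [exact: y_D | exact: y_C |].
by move=> t tl; apply: y_term.
Qed.

Let pred_hit x : x \in D -> nx x = v' -> x \in H.
Proof.
move=> xD e; apply: outside_hit => // [|t tl].
  by apply: contra v'_C => /CP [z ez]; rewrite -e ez czS cz_C.
by apply/eqP => ex; have := @v'_term t.+1 isT; rewrite -e ex eqxx.
Qed.

(* A hit point whose two neighbours are hit too has a private word of length one. *)
Let y_letter i x : i.+1 < l -> (forall k, k <= i -> wk k v' != s) -> wk i.+1 v' \in H ->
  nx v' != v' -> x \in H -> lab x = lab (wk i v') -> x = wk i v'.
Proof.
move=> il ns nxt nv xH xl; pose h := wk i v'.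
have hH : h \in H by apply: y_hit => //; nlia.
have hD := H_in_D hH; have om := o_m hH.
have no_loop : nx h != h.
  apply: contra nv => /eqP e; apply/eqP; apply: (@walk_inj i) => //; last first.
  - by rewrite -iterSr iterS -/h e; apply: H_neq_bot.
  - by rewrite -iterSr iterS -/h.
  - by have := @y_D 1; apply; nlia.
have o0 : o h = 0.
  apply/eqP; rewrite -leqn0 leqNgt; apply/negP => o0.
  pose x0 := wk (o h).-1 (sg h).
  have x0n : nx x0 = h by rewrite /x0 -iterS prednK // sg_o.
  have x0D : x0 \in D by apply: walk_D; [exact: sg_D | apply: sg_walk => //; nlia].
  have x0H : x0 \in H.
    case E: i => [|i']; first by apply: pred_hit => //; rewrite x0n /h E.
    have -> : x0 = wk i' v'.
      apply: nx_inj => //; last by rewrite x0n H_neq_bot.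
        by apply: y_D; nlia.
      by rewrite x0n /h E.
    by apply: y_hit => [|k ki]; [nlia | apply: ns; nlia].
  have e := @own_only h (o h).-1 hH ltac:(nlia) x0H.
  by case/eqP: no_loop; rewrite -{1}e.
have sgh : sg h = h by have := sg_o hH; rewrite o0.
have m1 : m h = 1.
  case: (ltngtP (m h) 1) => // m1; first by nlia.
  have := @own_only h 1 hH m1; rewrite sgh /= => e.
  by case/eqP: no_loop; apply: e; rewrite /h -iterS.
have := @private h x hH (H_in_D xH) _ 0; rewrite m1 /=; apply => //.
by case=> // _; rewrite sgh H_neq_bot.
Qed.

(** By [y_letter] no other hit point carries the letter of [wk i v'], which is the letter of this
    class on the cycle and on the path from [s]. *)
Let y_missing i : i.+1 < l -> (forall k, k <= i -> wk k v' != s) -> wk i.+1 v' \in H ->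
  nx v' != v' -> missing ((zu.+1 + i) %% L).
Proof.
move=> il ns nxt nv; have letter x := @y_letter i x il ns nxt nv; have il' := ltnW il.
apply/and3P; split; first by rewrite ltn_pmod.
  rewrite inF; apply/negP => cH; have := letter _ cH; rewrite -lab_y // => /(_ erefl) e.
  by have := y_C il'; rewrite -e cz_C.
apply/mapP => -[z zs e]; have [zb zH _ _] := tsP zs.
have := letter _ zH; rewrite lab_term // lab_y // (cz_mod e) => /(_ erefl) e1.
by have := @y_term i z il' ltac:(nlia) ns; rewrite e1 eqxx.
Qed.

(** Otherwise the hit points after [v'] make every class missing, although [F] is nonempty. If
    [nx v' = v'], the cycle is constantly labelled [lab v'] and the word of [v'] fits at a hit point
    of the cycle. *)
Let reach_s : exists2 b, b <= L & wk b v' = s.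
Proof.
have [/hasP [b]|/hasPn none] := boolP (has (fun b => wk b v' == s) (iota 0 L.+1)).
  by rewrite mem_iota => bL /eqP e; exists b.
have ns k : k <= L -> wk k v' != s by move=> kL; apply: none; rewrite mem_iota.
have hits k : k <= L -> wk k v' \in H.
  by move=> kL; apply: y_hit => [|i ik]; [nlia | apply: ns; nlia].
have [f fF] := F_nonempty; have fH : cz f \in H by rewrite -inF modn_small ?ltF.
have [loop|nv] := eqVneq (nx v') v'; last first.
  have [z zb ez] := residue_in_window zu.+1 (ltF fF).
  have := @y_missing (z - zu.+1) ltac:(nlia) _ (hits _ _) nv; rewrite subnKC ?ez; last by nlia.
  rewrite /missing fF andbF => P; suff : false by [].
  by apply: P => [k kz|]; [apply: ns|]; nlia.
have loops k : wk k v' = v' by elim: k => //= k ->.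
have labC z : lab (cz z) = lab v'.
  have [z' zb ez] := residue_in_window zu.+1 (ltn_pmod z L_gt0).
  rewrite -(cz_mod ez) -(@loops (z' - zu.+1)) lab_y; last by nlia.
  by rewrite subnKC //; nlia.
have v'H := hits 0 isT; rewrite /= in v'H.
have sgv : sg v' = v'.
  by apply: (@walk_inj (o v')); rewrite ?sg_D ?sg_o ?loops ?D_neq_bot.
have := @private v' (cz f) v'H (cz_D _) _ 0; rewrite /= => P.
have om := o_m v'H.
have e : cz f = v'.
  by apply: P => // [i im|]; [rewrite sgv cz_walk labC loops | nlia].
by have := v'_C; rewrite -e cz_C.
Qed.

Let sum_shift (g : nat -> nat) c : (forall z, g (z + L) = g z) ->
  \sum_(i < L) g (c + i) = \sum_(i < L) g i.
Proof.
move=> per; elim: c => // c <-.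
have [L' eL] : exists L', L = L'.+1 by exists L.-1; rewrite prednK.
rewrite eL big_ord_recr [RHS]big_ord_recl /= addn0 addnC; congr (_ + _).
  by rewrite addSnnS -eL per.
by apply: eq_bigr => i _; rewrite /bump /= addSnnS.
Qed.

(** If [b + L < l], the labels from [s] and those from its successor both run through a full period
    of the cycle, so [lab s] occurs equally often in both. Hence [wk L s], and with it the
    predecessor [cz 0] of [v], has the label of [s], against [lab_pred_v]. *)
Let reach_late b : wk b v' = s -> l <= b + L.
Proof.
move=> eb; rewrite leqNgt; apply/negP => lt.
pose g z : nat := lab (cz z) == lab s.
have per z : g (z + L) = g z by rewrite /g (@cz_mod (z + L) z) // modnDr.
have e1 : \sum_(i < L) g (zu.+1 + b + i) = \sum_(i < L) (lab (wk i s) == lab s).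
  apply: eq_bigr => i _; have iL := ltn_ord i.
  by rewrite /g -addnA -lab_y; [rewrite addnC iterD eb | nlia].
have e2 : \sum_(i < L) g (1 + i) = \sum_(i < L) (lab (wk i.+1 s) == lab s).
  by apply: eq_bigr => i _; have iL := ltn_ord i; rewrite /g add1n -lab_term //; nlia.
have e3 : \sum_(i < L) (lab (wk i s) == lab s) = \sum_(i < L) (lab (wk i.+1 s) == lab s).
  by rewrite -e1 -e2 !sum_shift.
pose f i : nat := lab (wk i s) == lab s.
have e4 : \sum_(i < L) f i + f L = f 0 + \sum_(i < L) f i.+1.
  by rewrite -(big_ord_recr _ (fun i : 'I_L.+1 => f i)) big_ord_recl.
have e5 : lab (wk L s) == lab s.
  move: e4; rewrite [X in X + _]e3 addnC => /addIn; rewrite /f eqxx.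
  by case: (lab (wk L s) == lab s).
rewrite lab_term in e5; last by nlia.
have e6 : cz L = cz 0 by apply: cz_mod; rewrite modnn mod0n.
rewrite e6 in e5; have := @lab_pred_v (cz 0) (cz_D _); rewrite czS cz_v // e5.
by move=> /(_ erefl).
Qed.

Lemma short_cycle_absurd : False.
Proof.
have [b0 b0L eb0] := reach_s.
have exb : exists b, wk b v' == s by exists b0; apply/eqP.
case: (ex_minnP exb) => b /eqP eb mn.
have bL : b <= L by apply: leq_trans b0L; apply: mn; apply/eqP.
have ns k : k < b -> wk k v' != s by move=> kb; apply/negP => /mn; rewrite leqNgt kb.
have lb := reach_late eb.
have nv : nx v' != v'.
  apply/eqP => loop; have loops k : wk k v' = v' by elim: k => //= k ->.
  by have := @s_not_on_cycle 1 isT; rewrite -eb loops /= loop eqxx.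
(* [i0 = 0] means that [s] itself is hit, which gives one more missing class. *)
have miss i : i.+1 < l -> (i.+1 < b) || (i.+1 == b) && (i0 == 0) -> missing ((zu.+1 + i) %% L).
  move=> il ib; have ib' : i < b by nlia.
  apply: y_missing => // [k ki|]; first by apply: ns; nlia.
  case/orP: ib => [lt|/andP [/eqP -> /eqP z0]].
    by apply: y_hit => [|k ki]; [|apply: ns]; nlia.
  by rewrite eb; have [_] := lateP i0_late; rewrite z0.
(* One missing class gives [L + i0 + 1 < l <= b + L], so a second class is missing as well, against
   [ts_full]. In the other case [l <= L + 1] and no class can be missing. *)
have [big|small] := boolP ((1 < b) || (0 < b) && (i0 == 0)).
  have m0 := @miss 0 ltac:(nlia) ltac:(nlia); have c := conflict m0.
  have m1 := @miss 1 ltac:(nlia) ltac:(nlia).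
  case/and3P: m0 => x1 x2 x3; case/and3P: m1 => y1 y2 y3.
  have := ts_two_missing x1 y1 _ x2 y2 x3 y3; rewrite ts_full ltnn => P.
  suff : false by []; apply: P; apply/eqP => e.
  have := modn_gap e; rewrite !addn0 addn1 => /(_ (ltnSn _)); nlia.
apply: none_missing_absurd => [||x]; [nlia|nlia|].
by apply/negP => /conflict; nlia.
Qed.
End ShortCycle.

Lemma late_absurd : False.
Proof.
have [|lt] := leqP l L; first exact: long_cycle_absurd.
have vC : v \in C by apply/CP; exists 1; rewrite cz_v.
have [|u [v' [/CP [zu uE] v'C v'D v'w v'l]]] := escape vC.
  by move=> x /CP [z ->]; rewrite czS cz_C.
exact: (@short_cycle_absurd lt u v' zu).
Qed.
End LateElement.

Lemma period_absurd : False.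
Proof.
case E: late => [|i0 r]; last by apply: (@late_absurd i0); rewrite E inE eqxx.
have := unhit_size unhit_known_uniq unhit_known_sub; have := few_unhit.
have := unhit_known_size; rewrite E; have := ts_full.
by move: (size unhit_known) (size ts) (size F) #|_| => /=; nlia.
Qed.
End Period.

Lemma cycle_absurd : False.
Proof.
have [L L0 [wL mn]] := cycle_length.
exact: (@period_absurd L).
Qed.
End CycleCase.

Lemma unhit_points : l <= #|D :\: H|.
Proof.
rewrite leqNgt; apply/negP => few.
apply: cycle_absurd => // p; apply/eqP => e.
by have := path_case e; rewrite leqNgt few.
Qed.
End Core.

(** * Windows of a string *)

Section Words.
Variables (T : eqType) (n : nat) (a : nat -> option T).
Hypothesis a_None : forall i, (a i == None) = (n <= i).
Local Notation X := 'I_n.+1.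

Definition same_word m y y' := [forall t : 'I_m, a (y + t) == a (y' + t)].
Local Notation mt := same_word.

Lemma mtP m y y' : reflect (forall t, t < m -> a (y + t) = a (y' + t)) (mt m y y').
Proof.
apply: (iffP forallP) => [h t tm|h t]; first exact/eqP/(h (Ordinal tm)).
exact/eqP/h.
Qed.

Lemma mt_refl m y : mt m y y.
Proof. exact/mtP. Qed.

Lemma mt_sym m y y' : mt m y y' = mt m y' y.
Proof. by apply/mtP/mtP => h t tm; rewrite h. Qed.

Lemma mt_trans m y1 y2 y3 : mt m y1 y2 -> mt m y2 y3 -> mt m y1 y3.
Proof. by move=> /mtP h1 /mtP h2; apply/mtP => t tm; rewrite h1 // h2. Qed.

Lemma mt_sub d m m' y y' : mt m y y' -> d + m' <= m -> mt m' (y + d) (y' + d).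
Proof. by move=> /mtP h le; apply/mtP => t tm; rewrite -!addnA h //; lia. Qed.

Lemma mt_le m m' y y' : mt m y y' -> m' <= m -> mt m' y y'.
Proof. by move=> h le; have := @mt_sub 0 m m' y y' h le; rewrite !addn0. Qed.

Lemma mt_next m y y' : mt m.+1 y y' -> mt m y.+1 y'.+1.
Proof. by move=> h; have := @mt_sub 1 m.+1 m y y' h (leqnn _); rewrite !addn1. Qed.

Lemma mt_first m y y' : a y = a y' -> mt m y.+1 y'.+1 -> mt m.+1 y y'.
Proof.
move=> e /mtP h; apply/mtP => -[|t] tm; first by rewrite !addn0.
by rewrite -!addSnnS h.
Qed.

Lemma a_lt i : (a i != None) = (i < n).
Proof. by rewrite a_None ltnNge. Qed.

Lemma mt_in m y y' : mt m y y' -> 0 < m -> y + m <= n -> y' + m <= n.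
Proof.
move=> /mtP h m0 ym; have := h m.-1 ltac:(lia) => e.
have : a (y' + m.-1) != None by rewrite -e a_lt; lia.
by rewrite a_lt; lia.
Qed.

Lemma mt_lt m y y' : mt m y y' -> 0 < m -> y < n -> y' < n.
Proof. by move=> /mtP h m0; have := h 0 m0; rewrite !addn0 => e; rewrite -!a_lt e. Qed.

Lemma mt_truncated m y y' : mt m y y' -> y < n -> n < y + m -> y' = y.
Proof.
move=> /mtP h yn nm; have h1 := h (n - y) ltac:(lia); have h2 := h (n - y).-1 ltac:(lia).
have : a (y' + (n - y)) == None by rewrite -h1 a_None; lia.
have : a (y' + (n - y).-1) != None by rewrite -h2 a_lt; lia.
by rewrite a_lt a_None; lia.
Qed.

Lemma mt_end m y : mt m y n -> 0 < m -> n <= y.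
Proof.
by move=> h m0; rewrite leqNgt; apply/negP => yn; have := mt_lt h m0 yn; rewrite ltnn.
Qed.

(** A canonical position for each window; [n] stands for the blank window, and the default is not
    reached for [y <= n]. *)
Definition window_class m y : X := odflt ord0 [pick y' : X | mt m y y'].
Local Notation cls := window_class.

Lemma cls_mt m y : y <= n -> mt m y (cls m y).
Proof.
move=> yn; rewrite /cls; case: pickP => // /(_ (Ordinal (yn : y < n.+1))) /=.
by rewrite mt_refl.
Qed.

Lemma cls_eqP m y y' : y <= n -> y' <= n -> reflect (cls m y = cls m y') (mt m y y').
Proof.
move=> yn yn'; apply: (iffP idP) => h.
  rewrite /cls (eq_pick (_ : _ =1 [pred z : X | mt m y' z])) // => z /=.
  by apply/idP/idP; [apply: mt_trans; rewrite mt_sym | apply: mt_trans].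
by apply: mt_trans (cls_mt m yn) _; rewrite h mt_sym cls_mt.
Qed.

Lemma cls_lt m y : 0 < m -> y < n -> cls m y < n.
Proof. by move=> m0 yn; apply: mt_lt (cls_mt m (ltnW yn)) m0 yn. Qed.

Lemma cls_id m y : y <= n -> cls m (cls m y) = cls m y.
Proof. by move=> yn; apply/esym/cls_eqP => //; [rewrite -ltnS | exact: cls_mt]. Qed.

Definition windows m : {set X} := [set cls m y | y : 'I_n].

Lemma windowsP m x : reflect (exists2 y, y < n & x = cls m y) (x \in windows m).
Proof.
apply: (iffP imsetP) => [[y _ ->]|[y yn ->]]; first by exists y.
by exists (Ordinal yn).
Qed.

Lemma windows_lt m x : 0 < m -> x \in windows m -> x < n.
Proof. by move=> m0 /windowsP [y yn ->]; apply: cls_lt. Qed.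

Lemma windows_cls m x : x \in windows m -> cls m x = x.
Proof. by case/windowsP => y yn ->; rewrite cls_id // ltnW. Qed.

Lemma cls_windows m y : y < n -> cls m y \in windows m.
Proof. by move=> yn; apply/windowsP; exists y. Qed.

Definition hit (G : {set 'I_n}) m y :=
  [exists g in G, [exists d : 'I_m, (d <= g) && mt m y (g - d)]].

Lemma hitP (G : {set 'I_n}) m y :
  reflect (exists y' (g : 'I_n), [/\ g \in G, mt m y y' & y' <= g < y' + m]) (hit G m y).
Proof.
apply: (iffP exists_inP) => [[g gG /existsP [d /andP [dg h]]]|[y' [g [gG h b]]]].
  by exists (g - d), g; split=> //; have := ltn_ord d; lia.
exists g => //; have dm : g - y' < m by lia.
apply/existsP; exists (Ordinal dm) => /=; rewrite leq_subr /=.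
by rewrite subKn //; lia.
Qed.

Lemma hit_mt G m y y' : mt m y y' -> hit G m y = hit G m y'.
Proof.
by move=> h; apply/hitP/hitP => -[z [g [gG hz b]]]; exists z, g; split=> //;
  apply: mt_trans hz; rewrite // mt_sym.
Qed.

Lemma hit_sub (G G' : {set 'I_n}) m y : G \subset G' -> hit G m y -> hit G' m y.
Proof.
by move=> /subsetP s /hitP [z [g [gG hz b]]]; apply/hitP; exists z, g; split=> //; apply: s.
Qed.

Definition att k (G : {set 'I_n}) :=
  [forall m : 'I_k.+1, forall y : X, (0 < m) && (y + m <= n) ==> hit G m y].

Lemma attP k G :
  reflect (forall m y, 0 < m <= k -> y + m <= n -> hit G m y) (att k G).
Proof.
apply: (iffP forallP) => [h m y /andP [m0 mk] ym|h m].
  have yn : y < n.+1 by lia.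
  have /forallP /(_ (Ordinal yn)) /= := h (Ordinal (mk : m < k.+1)).
  by rewrite m0 ym.
apply/forallP => y; apply/implyP => /andP [m0 ym]; apply: h => //.
by rewrite m0 -ltnS ltn_ord.
Qed.

Definition mini k (G : {set 'I_n}) := minset (att k) G.

Lemma mini_att k G : mini k G -> att k G.
Proof. exact: minsetp. Qed.

Definition private_word (G : {set 'I_n}) (g : 'I_n) i m :=
  [/\ i + m <= n, i <= g < i + m &
      forall y' (h : 'I_n), h \in G -> mt m i y' -> y' <= h < y' + m -> h = g].

Lemma private_of_unhit G (g : 'I_n) m y : y + m <= n -> hit G m y -> ~~ hit (G :\ g) m y ->
  exists2 i, mt m y i & private_word G g i m.
Proof.
move=> ym hG nh.
have only y' (h : 'I_n) : h \in G -> mt m y y' -> y' <= h < y' + m -> h = g.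
  move=> hG' hm b; apply/eqP; apply: contraR nh => ne.
  by apply/hitP; exists y', h; rewrite !inE ne hG'.
case/hitP: hG => i [h [hG hm b]]; have e := only _ _ hG hm b; rewrite e in b hG.
exists i => //; split=> //.
  by apply: (mt_in hm) => //; lia.
by move=> y' h' h'G hm' b'; apply: only b' => //; apply: mt_trans hm'.
Qed.

Lemma mini_private k G (g : 'I_n) : mini k G -> g \in G ->
  exists i m, m <= k /\ private_word G g i m.
Proof.
move=> mG gG; have aG := mini_att mG.
have /negP : ~ att k (G :\ g).
  move=> aG'; have [_ /(_ _ aG' (subsetDl _ _)) e] := minsetP mG.
  by have := gG; rewrite -e !inE eqxx.
case/forallPn => m /forallPn [y]; rewrite negb_imply => /andP [/andP [m0 ym] nh].
have mk : m <= k by rewrite -ltnS ltn_ord.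
have hG : hit G m y by apply: (attP _ _ aG) => //; rewrite m0.
by have [i _ p] := private_of_unhit ym hG nh; exists i, m.
Qed.

(** * Recurring suffixes and the upper bound on the number of windows *)

Definition recurs u := [exists y : X, (y != n - u :> nat) && mt u (n - u) y].

Lemma recursP u : reflect (exists2 y, y <> n - u & mt u (n - u) y /\ y <= n) (recurs u).
Proof.
apply: (iffP existsP) => [[y /andP [/eqP ne h]]|[y ne [h yn]]].
  by exists y => //; split=> //; rewrite -ltnS.
by exists (Ordinal (yn : y < n.+1)); rewrite /= h andbT; apply/eqP.
Qed.

Lemma recurs_full u : 0 < u -> recurs u -> u < n /\ (exists2 y, y + u < n & mt u (n - u) y).
Proof.
move=> u0 /recursP [y ne [h yn]].
have [un|nu] := ltnP n u.
  have [n0|n0] := posnP n; first by lia.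
  by have := mt_truncated h; lia.
have yu := mt_in h u0 ltac:(lia).
by split; [lia | exists y => //; lia].
Qed.

Lemma recurs_le u u' : 0 < u' <= u -> recurs u -> recurs u'.
Proof.
move=> b; have u0 : 0 < u by lia.
case/(recurs_full u0) => [un [y yn h]].
have h' := @mt_sub (u - u') u u' _ _ h ltac:(lia).
have e : n - u + (u - u') = n - u' by lia.
by apply/recursP; exists (y + (u - u')); [lia | rewrite -e; split=> //; lia].
Qed.

Definition recurring k := count recurs (iota 1 k.-1).

Lemma recurringS l : 0 < l -> recurring l.+1 = recurring l + recurs l.
Proof.
case: l => // l _; have e : iota 1 l.+1 = iota 1 l ++ [:: l.+1] by rewrite -{1}[l.+1]addn1 iotaD add1n.
by rewrite /recurring (_ : l.+2.-1 = l.+1) // e count_cat /= addn0.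
Qed.

Lemma recurring_full l : recurs l -> recurring l = l.-1.
Proof.
move=> r; rewrite -[RHS](size_iota 1); apply/eqP; rewrite -all_count.
by apply/allP => u; rewrite mem_iota => b; apply: recurs_le r; lia.
Qed.

(** The [bad] windows inject into the lengths of recurring suffixes; any other window starts at
    offset [d < k] before an element hitting it. *)
Lemma windows_le k G : 0 < k -> att k G -> #|windows k| <= k * #|G| + recurring k.
Proof.
move=> k0 /attP aG.
pose bad := [set x in windows k | (n < x + k) && recurs (n - x)].
have card_bad : #|bad| <= recurring k.
  rewrite /recurring -size_filter cardE -(size_map (fun x : X => n - x)).
  apply: uniq_leq_size.
    rewrite map_inj_in_uniq ?enum_uniq // => x y; rewrite !mem_enum !inE.
    move=> /andP [/(windows_lt k0) xn _] /andP [/(windows_lt k0) yn _] e.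
    by apply: val_inj => /=; lia.
  move=> y /mapP [x]; rewrite mem_enum inE => /andP [/(windows_lt k0) xn /andP [b r]] ->.
  by rewrite mem_filter r mem_iota /=; lia.
have card_rest : #|windows k :\: bad| <= k * #|G|.
  pose f (p : 'I_n * 'I_k) := cls k (p.1 - p.2).
  rewrite mulnC -[X in _ * X]card_ord -(cardsT 'I_k) -cardsX.
  apply: leq_trans (leq_imset_card f _); apply/subset_leq_card/subsetP => x.
  rewrite !inE negb_and => /andP [nb xw]; rewrite xw /= in nb.
  have xn := windows_lt k0 xw.
  (* Only the part of the window before the blanks, of length [minn k (n - x)], has to be hit. *)
  have [z [g [gG hm b]]] := hitP _ _ _ (aG (minn k (n - x)) x ltac:(lia) ltac:(lia)).
  have gn := ltn_ord g; have dk : g - z < k by lia.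
  apply/imsetP; exists (g, Ordinal dk); first by rewrite !inE gG.
  rewrite /f /= subKn; last by lia.
  rewrite -{1}(windows_cls xw); apply/cls_eqP; [by rewrite -ltnS | lia |].
  have [full|trunc] := leqP (x + k) n; first by rewrite (minn_idPl _) in hm => //; lia.
  rewrite trunc /= in nb; have -> : z = x; last exact: mt_refl.
  have [//|ne] := eqVneq z x; case/negP: nb; apply/recursP; exists z.
    by have -> : n - (n - x) = x; [lia | apply/eqP].
  have -> : n - (n - x) = x by lia.
  by rewrite (minn_idPr _) in hm; [split=> //; lia | lia].
have e : windows k :&: bad = bad by apply/setIidPr/subsetP => x; rewrite inE => /andP [].
by rewrite -(cardsID bad (windows k)) e addnC leq_add.
Qed.

Local Ltac mlia :=
  repeat match goal with
    | H : is_true (same_word _ _ _) |- _ => clear H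
    | H : is_true (~~ same_word _ _ _) |- _ => clear H
    | H : is_true (hit _ _ _) |- _ => clear H
    | H : is_true (mini _ _) |- _ => clear H
    | H : is_true (_ \subset _) |- _ => clear H
    | H : is_true (recurs _) |- _ => clear H
  end; nlia.

(** Extensions of [l]-windows are taken among these positions; the private words of [G :\: G2]
    occupy the remaining windows. *)
Definition good l (G2 : {set 'I_n}) y := (n <= y + l) || hit G2 l.+1 y.

Lemma good_mt l G2 y y' : y < n -> mt l.+1 y y' -> good l G2 y = good l G2 y'.
Proof.
move=> yn h; rewrite /good -(hit_mt G2 h); have [le|lt] := leqP n (y + l).
  have -> : y' = y by apply: mt_truncated h yn _; mlia.
  by rewrite le.
have -> // : (n <= y' + l) = false.
by have := mt_in h; mlia.
Qed.

Lemma good_near l (G2 : {set 'I_n}) (g : 'I_n) y : g \in G2 -> y <= g <= y + l -> good l G2 y.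
Proof.
move=> gG b; apply/orP; right; apply/hitP; exists y, g; split=> //; first exact: mt_refl.
by mlia.
Qed.

(** * From [l] to [l + 1] *)

Section Step.
Variables (l : nat) (G G2 : {set 'I_n}).
Hypothesis l_gt0 : 0 < l.
Hypothesis G_mini : mini l.+1 G.
Hypothesis G2_sub : G2 \subset G.
Hypothesis G2_mini : mini l G2.
Local Notation gd := (good l G2).

Let good_cls := [set x in windows l.+1 | gd x].
Let bad_cls := [set x in windows l.+1 | ~~ gd x].

(** [G2] hits every word of length at most [l], but no element of [G2] may hit a private word of an
    element outside [G2]. *)
Lemma long_private : exists f : 'I_n -> X,
  forall g, g \in G :\: G2 -> private_word G g (f g) l.+1.
Proof.
apply: (@fin_all_exists _ _ (fun g (x : X) => g \in G :\: G2 -> private_word G g x l.+1)) => g.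
have [|gn] := boolP (g \in G :\: G2); last by exists ord0.
rewrite inE => /andP [gG2 gG]; have [i [m [mk p]]] := mini_private G_mini gG.
have [im ig only] := p.
have em : m = l.+1.
  case: (ltngtP m l.+1) => // lt; last by mlia.
  have /hitP [z [h [hG2 hm b]]] : hit G2 m i.
    by apply: (attP _ _ (mini_att G2_mini)); mlia.
  have e := only z h (subsetP G2_sub _ hG2) hm b.
  by rewrite -e hG2 in gG2.
have il : i < n.+1 by mlia.
by exists (Ordinal il); rewrite -em.
Qed.

Lemma private_bad i (g : 'I_n) : g \in G :\: G2 -> private_word G g i l.+1 -> i < n /\ ~~ gd i.
Proof.
rewrite inE => /andP [gG2 gG] [im ig only]; split; first by mlia.
apply/norP; split; first by mlia.
apply/hitP => -[z [h [hG2 hm b]]].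
have e := only z h (subsetP G2_sub _ hG2) hm b.
by rewrite -e hG2 in gG2.
Qed.

Lemma private_cls_inj (f : 'I_n -> X) :
  (forall g, g \in G :\: G2 -> private_word G g (f g) l.+1) ->
  {in G :\: G2 &, injective (fun g => cls l.+1 (f g))}.
Proof.
move=> fP g h gG hG /cls_eqP hm; have [_ ig only] := fP g gG; have [_ ih _] := fP h hG.
apply/esym; apply: (only (f h)) => //; first by move: hG; rewrite inE => /andP [].
by apply: hm; rewrite -ltnS.
Qed.

Lemma private_cls_sub (f : 'I_n -> X) :
  (forall g, g \in G :\: G2 -> private_word G g (f g) l.+1) ->
  [set cls l.+1 (f g) | g in G :\: G2] \subset bad_cls.
Proof.
move=> fP; apply/subsetP => _ /imsetP [g gG ->].
have [fn nb] := private_bad gG (fP g gG).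
by rewrite inE cls_windows // -(good_mt _ fn (cls_mt _ (ltnW fn))).
Qed.

Lemma new_le : #|G :\: G2| <= #|bad_cls|.
Proof.
have [f fP] := long_private; rewrite -(card_in_imset (private_cls_inj fP)).
exact: subset_leq_card (private_cls_sub fP).
Qed.

(** A window reaching the end of the string is good already; any other is hit by [G2] at some
    occurrence, and so is its extension there. *)
Lemma good_rep y : y < n -> exists y1, [/\ y1 < n, gd y1 & mt l y y1].
Proof.
move=> yn; have [le|lt] := leqP n (y + l).
  by exists y; split=> //; [rewrite /good le | exact: mt_refl].
have /hitP [z [g [gG hm b]]] : hit G2 l y.
  by apply: (attP _ _ (mini_att G2_mini)); mlia.
have gn := ltn_ord g; exists z; split=> //; first by mlia.
by apply: good_near gG _; mlia.
Qed.

Let prefix_img : [set cls l x | x : X in good_cls] = windows l.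
Proof.
apply/setP => x; apply/imsetP/windowsP => [[y]|[y yn ->]].
  rewrite inE => /andP [yw _] ->; exists y => //; exact: windows_lt yw.
have [y1 [y1n gy1 h]] := good_rep yn; exists (cls l.+1 y1).
  by rewrite inE cls_windows // -(good_mt _ y1n (cls_mt _ (ltnW y1n))).
apply/cls_eqP; [exact: ltnW | by rewrite -ltnS |].
by apply: mt_trans h _; apply: mt_le (cls_mt l.+1 (ltnW y1n)) _.
Qed.

Let good_card : #|windows l| <= #|good_cls|.
Proof. by rewrite -prefix_img leq_imset_card. Qed.

Let split_card : #|good_cls| + #|bad_cls| = #|windows l.+1|.
Proof.
rewrite -(cardsID [set x : X | gd x] (windows l.+1)); congr (_ + _); apply: eq_card => x; rewrite !inE //.
by rewrite andbC.
Qed.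

Lemma step_le : #|G| + #|windows l| <= #|G2| + #|windows l.+1|.
Proof.
have := new_le; rewrite cardsD (setIidPr G2_sub).
have := good_card; have := split_card; have := subset_leq_card G2_sub; mlia.
Qed.

(** * The tight case: unique extensions on both sides *)

Section Tight.
Hypothesis G2_le : #|G2| + l.-1 <= #|windows l|.
Hypothesis l_recurs : recurs l.
Hypothesis G_big : #|windows l.+1| < #|G| + l.

Let card_facts : #|good_cls| = #|windows l| /\ #|G :\: G2| = #|bad_cls|.
Proof.
have := new_le; rewrite cardsD (setIidPr G2_sub).
have := good_card; have := split_card; have := subset_leq_card G2_sub; mlia.
Qed.

Lemma tight_card : #|G2| + l.-1 = #|windows l|.
Proof.
have := card_facts; rewrite cardsD (setIidPr G2_sub).
have := split_card; have := subset_leq_card G2_sub; mlia.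
Qed.

Lemma tight_onto (f : 'I_n -> X) :
  (forall g, g \in G :\: G2 -> private_word G g (f g) l.+1) ->
  forall y, y < n -> ~~ gd y -> exists2 g, g \in G :\: G2 & mt l.+1 y (f g).
Proof.
move=> fP y yn ny; have [_ e] := card_facts.
have /eqP ei : [set cls l.+1 (f g) | g in G :\: G2] == bad_cls.
  by rewrite eqEcard (private_cls_sub fP) (card_in_imset (private_cls_inj fP)) -e leqnn.
have : cls l.+1 y \in bad_cls.
  by rewrite inE cls_windows // -(good_mt _ yn (cls_mt _ (ltnW yn))).
rewrite -ei => /imsetP [g gG /cls_eqP h]; exists g => //.
by apply: h; [exact: ltnW | rewrite -ltnS].
Qed.

Let good_cls_mem y : y < n -> gd y -> cls l.+1 y \in good_cls.
Proof. by move=> yn gy; rewrite inE cls_windows // -(good_mt _ yn (cls_mt _ (ltnW yn))). Qed.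

(** Tightness makes the surjection from good windows to their prefixes of length [l] a bijection. *)
Lemma right_det y y' : y < n -> y' < n -> gd y -> gd y' -> mt l y y' -> mt l.+1 y y'.
Proof.
move=> yn yn' gy gy' h; have inj : {in good_cls &, injective (fun x : X => cls l x)}.
  by apply/imset_injP; rewrite prefix_img (proj1 card_facts).
apply/cls_eqP; rewrite ?(ltnW yn) ?(ltnW yn') //.
apply: inj; [exact: good_cls_mem | exact: good_cls_mem |].
apply/cls_eqP; [by rewrite -ltnS | by rewrite -ltnS |].
have h1 := mt_le (cls_mt l.+1 (ltnW yn)) (leqnSn l).
have h2 := mt_le (cls_mt l.+1 (ltnW yn')) (leqnSn l).
by apply: mt_trans h2; apply: mt_trans h; rewrite mt_sym.
Qed.

(** Only the one-letter window at [n - 1], which has nothing to its right, is left out. *)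
Let inner := [set x in good_cls | x.+1 < n].

Let inner_card : #|inner|.+1 = #|windows l|.
Proof.
have [ln _] := recurs_full l_gt0 l_recurs; have [e _] := card_facts.
have n1 : n.-1 < n by mlia.
have en : cls l.+1 n.-1 = n.-1 :> nat.
  by apply: mt_truncated (cls_mt _ _) _ _; mlia.
rewrite -e (cardsD1 (cls l.+1 n.-1) good_cls) good_cls_mem //; last by rewrite /good; mlia.
congr _.+1; apply: eq_card => x; rewrite !inE andbC; apply: andb_id2r => /andP [xw _].
have xn := windows_lt (ltn0Sn l) xw.
by rewrite -val_eqE /= en; mlia.
Qed.

Let suffix_img : windows l :\ cls l 0 \subset [set cls l x.+1 | x : X in inner].
Proof.
apply/subsetP => x; rewrite !inE => /andP [ne /windowsP [y yn ex]].
have n0 : ~~ mt l y 0.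
  by apply: contra ne => h; rewrite ex; apply/eqP/cls_eqP => //; apply: ltnW.
have y0 : y != 0 by apply: contra n0 => /eqP ->; rewrite mt_refl.
suff [y1 [y1n gy1 h]] : exists y1, [/\ y1.+1 < n, gd y1 & mt l y y1.+1].
  have y1n' := ltnW y1n; have hc := cls_mt l.+1 (ltnW y1n').
  have hn := mt_next hc; have lt1 : (cls l.+1 y1).+1 < n by apply: mt_lt hn _ _.
  apply/imsetP; exists (cls l.+1 y1); first by rewrite inE good_cls_mem.
  by rewrite ex; apply/cls_eqP; [exact: ltnW | exact: ltnW | apply: mt_trans hn].
have [tr|fu] := ltnP n (y + l).
  exists y.-1; rewrite prednK ?lt0n // mt_refl; split=> //.
  by rewrite /good; mlia.
have /hitP [z [g [gG hm b]]] : hit G2 l y.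
  by apply: (attP _ _ (mini_att G2_mini)); mlia.
have gn := ltn_ord g; have z0 : 0 < z by rewrite lt0n; apply: contra n0 => /eqP <-.
exists z.-1; rewrite prednK //; split=> //; first by mlia.
by apply: good_near gG _; mlia.
Qed.

(** The shifts of [inner] cover all [l]-windows but possibly the initial one, and [inner] is just
    one smaller than [windows l]; so shifting is injective. *)
Let suffix_card : #|[set cls l x.+1 | x : X in inner]| = #|inner|.
Proof.
apply/eqP; rewrite eqn_leq leq_imset_card /= -ltnS inner_card.
have := subset_leq_card suffix_img; rewrite (cardsD1 (cls l 0) (windows l)).
by case: (cls l 0 \in windows l); move: #|_ :\ _| #|[set _ | _ in _]| => x y /=; mlia.
Qed.

Let inner_mem y : y.+1 < n -> gd y -> cls l.+1 y \in inner /\ mt l y.+1 (cls l.+1 y).+1.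
Proof.
move=> yn gy; have hn := mt_next (cls_mt l.+1 (ltnW (ltnW yn))); split=> //.
by rewrite inE good_cls_mem ?(ltnW yn) //=; apply: mt_lt hn _ _.
Qed.

Lemma left_det y y' : y.+1 < n -> y'.+1 < n -> gd y -> gd y' -> mt l y.+1 y'.+1 -> mt l.+1 y y'.
Proof.
move=> yn yn' gy gy' h.
have inj : {in inner &, injective (fun x : X => cls l x.+1)}.
  by apply/imset_injP; rewrite suffix_card.
have [m1 h1] := inner_mem yn gy; have [m2 h2] := inner_mem yn' gy'.
have b1 : (cls l.+1 y).+1 < n by move: m1; rewrite inE => /andP [].
have b2 : (cls l.+1 y').+1 < n by move: m2; rewrite inE => /andP [].
apply/cls_eqP; [mlia|mlia|]; apply: inj => //; apply/cls_eqP; [mlia|mlia|].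
by apply: mt_trans h2; apply: mt_trans h; rewrite mt_sym.
Qed.

Lemma no_left_of_start y : y.+1 < n -> gd y -> ~~ mt l y.+1 0.
Proof.
move=> yn gy; apply/negP => h0; have [m1 h1] := inner_mem yn gy.
have b1 : (cls l.+1 y).+1 < n by move: m1; rewrite inE => /andP [].
have n0 : 0 < n by mlia.
have : windows l \subset [set cls l x.+1 | x : X in inner].
  apply/subsetP => x xw; have [e|ne] := eqVneq x (cls l 0); last first.
    by apply: (subsetP suffix_img); rewrite !inE ne.
  apply/imsetP; exists (cls l.+1 y) => //; rewrite e; apply/cls_eqP => //; first by mlia.
  by apply: mt_trans h1; rewrite mt_sym.
by move/subset_leq_card; rewrite suffix_card -inner_card ltnn.
Qed.

(* The suffix of length l has the truncated window as its only good right
   extension, so its other occurrences have unhit right extensions. *)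
Lemma suffix_bad x : x + l < n -> mt l (n - l) x -> ~~ gd x.
Proof.
move=> xn h; apply/negP => gx.
have h1 : mt l.+1 (n - l) x.
  apply: right_det => //; try mlia.
  by rewrite /good; mlia.
by have := mt_truncated h1; mlia.
Qed.
End Tight.
End Step.

(** * The graph of [l]-windows *)

Section TightAbsurd.
Variables (l : nat) (G G2 : {set 'I_n}) (e : 'I_n) (x : nat).
Hypothesis l_gt0 : 0 < l.
Hypothesis G_mini : mini l.+1 G.
Hypothesis G2_sub : G2 \subset G.
Hypothesis G2_mini : mini l G2.
Hypothesis G2_le : #|G2| + l.-1 <= #|windows l|.
Hypothesis l_recurs : recurs l.
Hypothesis G_big : #|windows l.+1| < #|G| + l.
Local Notation gd := (good l G2).
Hypothesis x_full : x + l < n.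
Hypothesis x_suffix : mt l (n - l) x.
Hypothesis e_near : x <= e <= x + l.
Hypothesis e_only : forall y, y <= e <= y + l -> ~~ gd y -> mt l.+1 y x.
Hypothesis x_min : forall y, y < x -> y <= e <= y + l -> gd y.
Hypothesis e_free : forall g, g \in G2 -> exists i m,
  [/\ m <= l, private_word G2 g i m & forall y, mt m i y -> ~~ (y <= e < y + m)].

Let pt y := cls l y.
Let bot : X := ord_max.
(** A good occurrence of [w] is moved one position to the right; by [rdet] the result does not
    depend on the occurrence. *)
Let nx (w : X) : X := if w == bot then bot else
  pt (odflt ord0 [pick y : X | [&& y < n, gd y & mt l w y]]).+1.
Local Notation wk i w := (iter i nx w).
Let D := windows l.
Let H := [set pt g | g : 'I_n in G2].

Let rdet y y' : y < n -> y' < n -> gd y -> gd y' -> mt l y y' -> mt l.+1 y y'.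
Proof. by apply: (right_det (G := G)). Qed.

Let ldet y y' : y.+1 < n -> y'.+1 < n -> gd y -> gd y' -> mt l y.+1 y'.+1 -> mt l.+1 y y'.
Proof. by apply: (left_det (G := G)). Qed.

Let no_start y : y.+1 < n -> gd y -> ~~ mt l y.+1 0.
Proof. by apply: (no_left_of_start (G := G)). Qed.

Let x_bad : ~~ gd x.
Proof. by apply: (suffix_bad (G := G)). Qed.

Let pt_eq y y' : y <= n -> y' <= n -> pt y = pt y' -> mt l y y'.
Proof. by move=> yn yn' /cls_eqP; apply. Qed.

Let eq_pt y y' : y <= n -> y' <= n -> mt l y y' -> pt y = pt y'.
Proof. by move=> yn yn' h; apply/cls_eqP. Qed.

Let pt_n : pt n = bot.
Proof.
apply: val_inj => /=; have h := cls_mt l (leqnn n); rewrite mt_sym in h.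
have := mt_end h l_gt0; have := ltn_ord (pt n); rewrite /pt; mlia.
Qed.

Let pt_lt y : y < n -> pt y != bot.
Proof. by move=> yn; rewrite -val_eqE /= neq_ltn cls_lt. Qed.

Let pt_bot y : y <= n -> pt y = bot -> y = n.
Proof. by move=> yn h; case: (ltngtP y n) => // [/pt_lt|]; [rewrite h eqxx | mlia]. Qed.

Let nx_pick w : w != bot -> (exists2 y, y < n & gd y /\ mt l w y) ->
  exists y, [/\ y < n, gd y, mt l w y & nx w = pt y.+1].
Proof.
move=> wb [y yn [gy h]]; rewrite /nx (negbTE wb).
case: pickP => [z /and3P [zn gz hz]|/(_ (Ordinal (ltnW yn : y < n.+1)))]; last by rewrite /= yn gy h.
by exists z.
Qed.

Let nx_good y : y < n -> gd y -> nx (pt y) = pt y.+1.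
Proof.
move=> yn gy; have hy := cls_mt l (ltnW yn).
have [|z [zn gz hz ->]] := nx_pick (pt_lt yn).
  by exists y => //; split=> //; rewrite mt_sym.
apply: eq_pt => //; apply: mt_next; rewrite mt_sym.
by apply: rdet => //; apply: mt_trans hz.
Qed.

Let D_good w : w \in D -> exists y, [/\ y < n, gd y & w = pt y].
Proof.
case/windowsP => y yn ->; have [z [zn gz h]] := good_rep l_gt0 G2_mini yn.
by exists z; split=> //; apply: eq_pt => //; apply: ltnW.
Qed.

Let pt_D y : y < n -> pt y \in D.
Proof. exact: cls_windows. Qed.

Let nx_bot : nx bot = bot.
Proof. by rewrite /nx eqxx. Qed.

Let bot_D : bot \notin D.
Proof. by apply/negP => /(windows_lt l_gt0); rewrite ltnn. Qed.

Let nx_D w : w \in D -> nx w != bot -> nx w \in D.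
Proof.
case/D_good => y [yn gy ->]; rewrite nx_good // => h.
by apply: pt_D; case: (ltngtP y.+1 n) h => // [|->]; [mlia | rewrite pt_n eqxx].
Qed.

Let nx_inj w w' : w \in D -> w' \in D -> nx w = nx w' -> nx w != bot -> w = w'.
Proof.
case/D_good => y [yn gy ->] /D_good [y' [yn' gy' ->]]; rewrite !nx_good // => h nb.
have y1 : y.+1 < n by case: (ltngtP y.+1 n) nb => // [|->]; [mlia | rewrite pt_n eqxx].
rewrite h in nb.
have y1' : y'.+1 < n by case: (ltngtP y'.+1 n) nb => // [|->]; [mlia | rewrite pt_n eqxx].
apply: eq_pt; [exact: ltnW | exact: ltnW |]; apply: (@mt_le l.+1) => //.
by apply: ldet => //; apply: pt_eq.
Qed.

Let walk_real t y : (forall c, c < t -> y + c < n /\ gd (y + c)) -> wk t (pt y) = pt (y + t).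
Proof.
elim: t => [|t IH] h; first by rewrite addn0.
have [yn gy] := h t (ltnSn t).
by rewrite iterS IH => [|c ct]; [rewrite nx_good // addnS | apply: h; mlia].
Qed.

(** A walk may jump between occurrences of the same window, but it still reads the letters after [y]
    for [l] steps. *)
Let read t y : y <= n -> t <= l -> exists z, [/\ z <= n, wk t (pt y) = pt z & mt (l - t) (y + t) z].
Proof.
move=> yn; elim: t => [|t IH] tl; first by exists y; rewrite subn0 addn0 mt_refl.
have [z [zn ez hz]] := IH (ltnW tl).
have el : l - t = (l - t.+1).+1 by mlia.
have [zlt|zge] := ltnP z n; last first.
  have ez' : z = n by mlia.
  exists n; split=> //; first by rewrite iterS ez ez' pt_n nx_bot.
  rewrite ez' in hz; have yt := mt_end hz ltac:(mlia).
  apply/mtP => c _; apply/eqP; have -> : a (n + c) = None by apply/eqP; rewrite a_None; mlia.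
  by rewrite a_None; mlia.
have [z1 [z1n gz1 h1]] := good_rep l_gt0 G2_mini zlt.
exists z1.+1; split=> //.
  by rewrite iterS ez (eq_pt _ _ h1) ?nx_good // ltnW.
rewrite addnS; apply: mt_next; rewrite -el; apply: mt_trans hz _.
by apply: mt_le h1 _; mlia.
Qed.

Let lab_pt y : y <= n -> a (pt y) = a y.
Proof. by move=> yn; have /mtP /(_ 0 l_gt0) := cls_mt l yn; rewrite !addn0 => ->. Qed.

Let lab_walk t y : y <= n -> t < l -> a (wk t (pt y)) = a (y + t).
Proof.
move=> yn tl; have [z [zn -> /mtP h]] := read yn (ltnW tl).
by rewrite lab_pt //; have := h 0; rewrite !addn0 => -> //; mlia.
Qed.

Let bot_lab (w : X) : (w == bot) = (a w == None).
Proof. by rewrite a_None -val_eqE /=; have := ltn_ord w; mlia. Qed.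

Let walk_lt t y : y <= n -> t < l -> (wk t (pt y) != bot) = (y + t < n).
Proof. by move=> yn tl; rewrite bot_lab lab_walk // a_lt. Qed.

Let wD := walk_D nx_bot nx_D.
Let winj := walk_inj nx_bot nx_D nx_inj.
Let wback := walk_back nx_bot nx_D nx_inj.

(** Backward walks follow the string through good positions, and by [no_start] they cannot continue
    past position [0]. *)
Let back z t w : w \in D -> z < n -> (forall c, c < z -> z <= c + t -> gd c) ->
  wk t w = pt z -> t <= z /\ w = pt (z - t).
Proof.
move=> wDD zn gz ez; have nb := pt_lt zn; have [tz|zt] := leqP t z.
  split=> //; have real : wk t (pt (z - t)) = pt z.
    by rewrite walk_real ?subnK // => c ct; split; [|apply: gz]; mlia.
  by apply: (@winj t) => //; rewrite ?ez ?real //; apply: pt_D; mlia.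
have real : wk z (pt 0) = pt z by rewrite walk_real // => c cz; split; [|apply: gz]; mlia.
have n0 : 0 < n by mlia.
have nb' : wk (t - z) w != bot.
  by apply: (@walk_le _ _ _ nx_bot t); rewrite ?ez ?leq_subr.
have ew : wk z (wk (t - z) w) = pt z by rewrite -iterD subnKC ?ez // ltnW.
have e0 : wk (t - z) w = pt 0.
  by apply: (winj (wD wDD nb') (pt_D n0) (i := z)); rewrite ew.
have [y [yn gy ey]] : exists y, [/\ y < n, gd y & wk (t - z).-1 w = pt y].
  apply: D_good; apply: wD => //.
  by apply: (@walk_le _ _ _ nx_bot _ _ _ nb'); apply: leq_pred.
have ee : pt y.+1 = pt 0.
  have tz0 : 0 < t - z by rewrite subn_gt0.
  by rewrite -nx_good // -ey -iterS (prednK tz0) e0.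
have y1 : y.+1 < n.
  by case: (ltngtP y.+1 n) (pt_lt n0) => // [|y1]; [mlia | rewrite -ee y1 pt_n eqxx].
by have := no_start y1 gy; rewrite (pt_eq _ _ ee) // ltnW.
Qed.

Let pt_G2 (g : 'I_n) c : g \in G2 -> c <= g -> g <= c + l -> gd c.
Proof. by move=> gG cg gc; apply: good_near gG _; mlia. Qed.

Let back_G2 (g : 'I_n) t w : g \in G2 -> w \in D -> t <= l -> wk t w = pt g -> t <= g /\ w = pt (g - t).
Proof.
move=> gG wDD tl; apply: back => // c cg gc.
by apply: pt_G2 gG _ _; mlia.
Qed.

(** If [g] and [g'] shared a window, walking back from [g'] would find the private word of [g]
    around [g']. *)
Let pt_inj : {in G2 &, injective (fun g : 'I_n => pt g)}.
Proof.
move=> g g' gG gG' ee; have [i [m [ml [im ig only] _]]] := e_free gG; have gn := ltn_ord g.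
have ei : wk (g - i) (pt i) = pt g'.
  rewrite -ee walk_real ?subnKC //; first by mlia.
  by move=> c ci; split; [mlia | apply: pt_G2 gG _ _; mlia].
have in_D : pt i \in D by apply: pt_D; mlia.
have tl : g - i <= l by mlia.
have [le ew] := back_G2 gG' in_D tl ei; have gn' := ltn_ord g'.
apply/esym; apply: (only (g' - (g - i))) => //; last by mlia.
apply: (@mt_le l) => //; apply: pt_eq => //; mlia.
Qed.

Let s := pt (n - l).
Let v := pt x.+1.

Let walk_s i : i <= l -> wk i s = pt (n - l + i).
Proof. by move=> il; apply: walk_real => c ci; split; [mlia | rewrite /good; mlia]. Qed.

Let s_eq : s = pt x.
Proof. by apply: eq_pt => //; mlia. Qed.

Lemma tight_absurd : False.
Proof.
have [w wP] : exists w : X -> 'I_n * nat * nat, forall h, h \in H ->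
    [/\ (w h).1.1 \in G2, h = pt (w h).1.1, (w h).2 <= l,
      private_word G2 (w h).1.1 (w h).1.2 (w h).2 &
      forall y, mt (w h).2 (w h).1.2 y -> ~~ (y <= e < y + (w h).2)].
  apply: (@fin_all_exists _ _ (fun h (p : 'I_n * nat * nat) => h \in H ->
    [/\ p.1.1 \in G2, h = pt p.1.1, p.2 <= l, private_word G2 p.1.1 p.1.2 p.2 &
      forall y, mt p.2 p.1.2 y -> ~~ (y <= e < y + p.2)])) => h.
  have [/imsetP [g gG hg]|hn] := boolP (h \in H); last by exists (e, 0, 0).
  have [i [m [ml pr fr]]] := e_free gG.
  by exists (g, i, m).
pose g h := (w h).1.1; pose i h := (w h).1.2; pose m h := (w h).2.
have en := ltn_ord e.
have fact h : h \in H -> [/\ g h \in G2, h = pt (g h), m h <= l, i h + m h <= n & i h <= g h < i h + m h].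
  by move=> hH; have [gG hg ml [im ig _] _] := wP h hH.
have only h y (g' : 'I_n) : h \in H -> g' \in G2 -> mt (m h) (i h) y -> y <= g' < y + m h -> g' = g h.
  by move=> hH; have [_ _ _ [_ _ oo] _] := wP h hH; apply: oo.
have free h y : h \in H -> mt (m h) (i h) y -> ~~ (y <= e < y + m h).
  by move=> hH; have [_ _ _ _ ff] := wP h hH; apply: ff.
have occ h y : h \in H -> y <= n ->
    (forall t, t < m h -> wk t (pt y) != bot /\ a (wk t (pt y)) = a (wk t (pt (i h)))) ->
    mt (m h) (i h) y.
  move=> hH yn lb; have [_ _ ml im ig] := fact h hH; apply/mtP => t tm.
  have [_] := lb t tm; rewrite !lab_walk //; mlia.
have xn : x < n by mlia.
have := @unhit_points X (option T) bot nx (fun w : X => a w) D H l s v (e - x)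
  (fun h => pt (i h)) m (fun h => g h - i h).
have -> : #|D :\: H| = l.-1.
  have HD : H \subset D by apply/subsetP => _ /imsetP [g0 _ ->]; apply: pt_D.
  have tc := tight_card l_gt0 G_mini G2_sub G2_mini G2_le G_big.
  have cH : #|H| = #|G2| by apply: card_in_imset.
  by rewrite cardsD (setIidPr HD) cH /D -tc addKn.
move=> core; have : l <= l.-1; last by mlia.
  apply: core.
  - exact: nx_bot.
  - exact: bot_D.
  - exact: nx_D.
  - exact: nx_inj.
  - by apply/subsetP => _ /imsetP [g0 _ ->]; apply: pt_D.
  - by apply: pt_D; mlia.
  - by apply: pt_D; mlia.
  - by move=> t tl; rewrite walk_lt; mlia.
  - by rewrite walk_s // subnK ?pt_n //; mlia.
  - by move=> t tl; rewrite walk_lt; mlia.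
  - move=> t tl; rewrite !lab_walk; try mlia.
    by have /mtP /(_ t.+1 tl) -> := x_suffix; rewrite addSnnS.
  (* A good predecessor of [v] starting with the first letter of the suffix would show the bad word
     at [x]. *)
  - move=> u /D_good [y [yn gy ->]]; rewrite nx_good // => ev.
    rewrite !lab_pt ?leq_subr 1?ltnW //; apply/eqP => es.
    have h1 : mt l y.+1 x.+1 by apply: pt_eq.
    have h2 : a y = a x by rewrite es; have /mtP /(_ 0 l_gt0) := x_suffix; rewrite !addn0.
    by have := x_bad; rewrite -(good_mt _ yn (mt_first h2 h1)) gy.
  - move=> u /D_good [y [yn gy ->]]; rewrite nx_good // => /pt_bot ey.
    by rewrite walk_s; [congr (pt _); have := ey yn; mlia | mlia].
  - by mlia.
  - by move=> h hH; have [_ _ ml im ig] := fact h hH; apply: pt_D; mlia.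
  - by move=> h hH; have [_ _ ml im ig] := fact h hH; mlia.
  - move=> h hH; have [gG hg ml im ig] := fact h hH; have gn := ltn_ord (g h).
    rewrite walk_real ?subnKC //; first by mlia.
    by move=> c ci; split; [mlia | apply: pt_G2 gG _ _; mlia].
  - move=> h t hH tm; have [_ _ ml im ig] := fact h hH.
    by rewrite walk_lt; mlia.
  - move=> h u hH uD lb t tm tH; have [gG hg ml im ig] := fact h hH.
    case/imsetP: tH => g' gG' eg'; have gn' := ltn_ord g'.
    have tl : t <= l by mlia.
    have [le eu] := back_G2 gG' uD tl eg'.
    have oc : mt (m h) (i h) (g' - t) by apply: occ => //; [mlia | rewrite -eu].
    by rewrite eg' hg (only h _ g' hH gG' oc) //; mlia.
  (* The word would occur around [e]: in the copy of the suffix at [x], or starting left of [x],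
     where [x_min] lets the backward walk follow the string. *)
  - move=> h u hH uD jl lb t tm; have [gG hg ml im ig] := fact h hH; apply/eqP => et.
    have [tj|jt] := leqP t (e - x).
      have eu : u = wk (e - x - t) s.
        by apply: wback => //; [apply: pt_D; mlia | rewrite walk_s ?pt_lt //; mlia].
      rewrite walk_s in eu; last by mlia.
      have oc : mt (m h) (i h) (n - l + (e - x - t)) by apply: occ => //; [mlia | rewrite -eu].
      have inn := mt_in oc ltac:(mlia) im.
      have oc2 : mt (m h) (n - l + (e - x - t)) (x + (e - x - t)).
        by apply: mt_sub x_suffix _; mlia.
      by have := free h _ hH (mt_trans oc oc2); mlia.
    have es : wk (t - (e - x)) u = pt x.
      rewrite -s_eq; apply/esym; apply: (wback (a := e - x)) => //.
      - by apply: pt_D; mlia.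
      - by rewrite et walk_s ?pt_lt //; mlia.
      - exact: ltnW.
    have [le eu] : t - (e - x) <= x /\ u = pt (x - (t - (e - x))).
      by apply: back => // c cx xc; apply: x_min; mlia.
    have oc : mt (m h) (i h) (x - (t - (e - x))) by apply: occ => //; [mlia | rewrite -eu].
    by have := free h _ hH oc; mlia.
  (* The walk from [v] reads the letters after [x]: it follows the string up to the first bad
     position, where by [e_only] the window is [s] again, and then reads the suffix. *)
  - move=> h c hH cj lb; have [gG hg ml im ig] := fact h hH.
    suff oc : mt (m h) (i h) (x.+1 + c) by have := free h _ hH oc; mlia.
    apply/mtP => t tm; have [nb] := lb t tm.
    rewrite [RHS]lab_walk; [|mlia|mlia]; move=> <-.
    have [/hasP [d]|/hasPn allg] := boolP (has (fun d => ~~ gd (x.+1 + d)) (iota 0 c)); last first.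
      rewrite addnC iterD walk_real ?lab_walk //; try mlia.
      move=> d dc; split; first by mlia.
      by apply/negPn; apply: allg; rewrite mem_iota.
    move=> dI nd; have exd : exists d, (d < c) && ~~ gd (x.+1 + d).
      by exists d; rewrite nd andbT; move: dI; rewrite mem_iota.
    case: (ex_minnP exd) => d0 /andP [d0c nd0] dmin.
    have hx := e_only (y := x.+1 + d0) ltac:(mlia) nd0.
    have hs : mt l (n - l) (x.+1 + d0).
      by apply: mt_trans x_suffix _; rewrite mt_sym; apply: mt_le hx _.
    have ws : wk d0 v = s.
      rewrite walk_real; first by apply: eq_pt; [mlia | mlia | rewrite mt_sym].
      move=> d1 d1c; split; first by mlia.
      apply/negPn/negP => nd1; have := dmin d1; rewrite nd1 andbT => /(_ ltac:(mlia)); mlia.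
    have ec : c + t = (c - d0 + t) + d0 by mlia.
    rewrite ec iterD ws in nb *.
    have small : c - d0 + t < l.
      rewrite ltnNge; apply/negP => big.
      by move: nb; rewrite -(subnK big) iterD walk_s // subnK ?pt_n ?walk_bot ?eqxx //; mlia.
    rewrite lab_walk //; last by mlia.
    have /mtP /(_ _ small) -> := hs; congr a; mlia.
  - have /hitP [z [g0 [gG hm b]]] : hit G2 l x.+1.
      by apply: (attP _ _ (mini_att G2_mini)); mlia.
    have gn := ltn_ord g0; exists (g0 - z); first by mlia.
    have -> : v = pt z by apply: eq_pt => //; mlia.
    rewrite walk_real ?subnKC; [exact: imset_f|mlia|].
    by move=> c ci; split; [mlia | apply: pt_G2 gG _ _; mlia].
  (* [s] walks to [bot] and is thus not in [C], so the string leaves [C] between the positions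
     [x + 1] and [n - l]. *)
  - move=> C vC closed.
    have sC : s \notin C.
      apply/negP => sC; have cl t : wk t s \in C.
        by elim: t => // t /closed [].
      have [bD _] := closed _ (cl l); move: bD.
      by rewrite walk_s // subnK ?pt_n ?(negbTE bot_D) //; mlia.
    have [y [xy yl yC ynC]] : exists y, [/\ x < y, y < n - l, pt y \in C & pt y.+1 \notin C].
      have [/hasP [d]|/hasPn allin] := boolP (has (fun d => pt (x.+1 + d) \notin C) (iota 0 (n - l - x))).
        move=> dI nd; have exd : exists d, (d < n - l - x) && (pt (x.+1 + d) \notin C).
          by exists d; rewrite nd andbT; move: dI; rewrite mem_iota.
        case: (ex_minnP exd) => -[|d0] /andP [d0c nd0] dmin; first by rewrite addn0 vC in nd0.
        exists (x.+1 + d0); rewrite -addnS; split=> //; try mlia.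
        by apply/negPn/negP => nd1; have := dmin d0; rewrite nd1 andbT => /(_ (ltnW d0c)); rewrite ltnn.
      have := allin (n - l - x).-1; rewrite mem_iota.
      have -> : x.+1 + (n - l - x).-1 = n - l by mlia.
      by rewrite negbK (negbTE sC) => /(_ ltac:(mlia)).
    exists (pt y), (pt y.+1); split=> //.
    + by apply: pt_D; mlia.
    + by move=> t tl; rewrite walk_lt; mlia.
    + by move=> t tl; rewrite !lab_walk ?addnS //; mlia.
Qed.
End TightAbsurd.

(** * The induction on the word length *)

Lemma att_le k k' G : k' <= k -> att k G -> att k' G.
Proof. by move=> le /attP h; apply/attP => m y b ym; apply: h => //; mlia. Qed.

Lemma att_sub k (G G' : {set 'I_n}) : G \subset G' -> att k G -> att k G'.
Proof. by move=> s /attP h; apply/attP => m y b ym; apply: hit_sub s _; apply: h. Qed.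

Lemma mini_exists k G : att k G -> exists2 G', mini k G' & G' \subset G.
Proof. by move=> aG; have [G' mG s] := minset_exists aG; exists G'. Qed.

Lemma mini_one_le G : mini 1 G -> #|G| <= #|windows 1|.
Proof.
move=> mG; rewrite -(@card_in_imset _ _ (fun g : 'I_n => cls 1 g) (mem G)).
  by apply/subset_leq_card/subsetP => _ /imsetP [g _ ->]; apply: cls_windows.
move=> g h gG hG /cls_eqP hm.
have [i [m [m1 [im ig only]]]] := mini_private mG gG.
have [em ei] : m = 1 /\ i = g by mlia.
apply/esym; apply: (only h) => //; last by mlia.
by rewrite em ei; apply: hm; apply: ltnW.
Qed.

(** Tightness gives [G3] the size of [G2], so [G3] is all of [e |: (G2 :\ g)]. Then [e] hits the
    window at [x], which [suffix_bad] for [G3] forbids. *)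
Lemma tight_swap_absurd l (G G2 G3 : {set 'I_n}) (g e : 'I_n) x :
  0 < l -> mini l.+1 G -> recurs l -> #|windows l.+1| < #|G| + l ->
  (forall G', mini l G' -> #|G'| + l.-1 <= #|windows l|) ->
  G2 \subset G -> mini l G2 -> g \in G2 -> e \in G -> mini l G3 -> G3 \subset e |: (G2 :\ g) ->
  x + l < n -> mt l (n - l) x -> x <= e <= x + l -> False.
Proof.
move=> l0 mG rl big IH sG2 mG2 gG2 eG mG3 sG3 xn xs xe.
have sG3' : G3 \subset G.
  apply: subset_trans sG3 _; rewrite subUset sub1set eG /=.
  exact: subset_trans (subsetDl _ _) sG2.
have c2 := tight_card l0 mG sG2 mG2 (IH _ mG2) big.
have c3 := tight_card l0 mG sG3' mG3 (IH _ mG3) big.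
have c1 : #|e |: (G2 :\ g)| <= #|G3|.
  have -> : #|G3| = #|G2| by apply/eqP; rewrite -(eqn_add2r l.-1) c2 c3.
  by rewrite (cardsD1 g G2) gG2 cardsU1 leq_add2r leq_b1.
have /eqP e3 : G3 == e |: (G2 :\ g) by rewrite eqEcard sG3 c1.
have := suffix_bad l0 mG sG3' mG3 (IH _ mG3) rl big xn xs.
by rewrite (@good_near l G3 e x) // e3 setU11.
Qed.

Lemma mini_le k G : 0 < k -> mini k G -> #|G| + recurring k <= #|windows k|.
Proof.
case: k => // k _; elim: k G => [|k IH] G mG.
  by rewrite addn0; apply: mini_one_le.
move: k.+1 (ltn0Sn k) IH mG => l l0 IH mG.
have [G2 mG2 sG2] := mini_exists (att_le (leqnSn l) (mini_att mG)).
have IH2 := IH G2 mG2; have st := step_le l0 mG sG2 mG2.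
rewrite recurringS //; have [rl|nrl] := boolP (recurs l); last by mlia.
have rE := recurring_full rl; rewrite rE in IH2.
have IH' G' : mini l G' -> #|G'| + l.-1 <= #|windows l| by rewrite -rE; apply: IH.
rewrite rE leqNgt; apply/negP => big0.
have big : #|windows l.+1| < #|G| + l by mlia.
have [ln [x0 x0n x0s]] := recurs_full l0 rl.
have x0b := suffix_bad l0 mG sG2 mG2 IH2 rl big x0n x0s.
have [f fP] := long_private l0 mG sG2 mG2.
have x0n' : x0 < n by mlia.
have [e eG hx0] := tight_onto l0 mG sG2 mG2 IH2 big fP x0n' x0b.
have [_ eb eonly] := fP e eG.
have eG' : e \in G by move: eG; rewrite inE => /andP [].
(* The leftmost occurrence covering [e] is chosen, so that windows further left that cover [e] are
   good. *)
have exx : exists y, mt l.+1 x0 y && (y <= e <= y + l) by exists (f e); rewrite hx0; mlia.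
case: (ex_minnP exx) => x /andP [x0x xe] xmin.
have xs : mt l (n - l) x by apply: mt_trans x0s _; apply: mt_le x0x _.
have xn : x + l < n by have := mt_in x0x; mlia.
have e_only y : y <= e <= y + l -> ~~ good l G2 y -> mt l.+1 y x.
  move=> ye nb; have en := ltn_ord e; have yn : y < n by mlia.
  have [e' eG2 hy] := tight_onto l0 mG sG2 mG2 IH2 big fP yn nb.
  have [_ _ only'] := fP e' eG2.
  have ee : e = e' by apply: (only' y) => //; [rewrite mt_sym | mlia].
  rewrite -ee in hy; apply: mt_trans hy _; rewrite mt_sym.
  by apply: mt_trans hx0; rewrite mt_sym.
apply: (@tight_absurd l G G2 e x) => //.
- move=> y yx ye; apply/negPn/negP => nb; have := xmin y; rewrite ye andbT leqNgt yx.
  by move=> C; suff : false by []; apply: C; apply: mt_trans x0x _; rewrite mt_sym e_only.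
(* Since the swap fails, some word is hit by [G2] but not after replacing [g] by [e]: a private word
   of [g] that avoids [e]. *)
- move=> g gG2; have [aG1|] := boolP (att l (e |: (G2 :\ g))).
    have [G3 mG3 sG3] := mini_exists aG1.
    by case: (@tight_swap_absurd l G G2 G3 g e x).
  case/forallPn => m /forallPn [y]; rewrite negb_imply => /andP [/andP [m0 ym] nh].
  have ml : m <= l by rewrite -ltnS ltn_ord.
  have hG : hit G2 m y by apply: (attP _ _ (mini_att mG2)) => //; rewrite m0.
  have nh2 : ~~ hit (G2 :\ g) m y by apply: contra nh; apply: hit_sub; apply: subsetUr.
  have [i hi pr] := private_of_unhit ym hG nh2; exists i, m; split=> // y' hy'.
  apply: contra nh => b; apply/hitP; exists y', e; split=> //; first exact: setU11.
  exact: mt_trans hy'.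
Qed.
End Words.

(** * From strings to words padded with blanks *)

Section Strings.
Variables (T : eqType) (n : nat) (S : n.-tuple T).

Definition letter i : option T := nth None (map Some S) i.

Lemma letter_None i : (letter i == None) = (n <= i).
Proof.
rewrite /letter; have [le|lt] := leqP n i.
  by rewrite nth_default ?eqxx // size_map size_tuple.
have [x0 _] : exists x0 : T, true by case: (tval S) (size_tuple S) => [/= e|x0]; [rewrite -e in lt | exists x0].
by rewrite (nth_map x0) // size_tuple.
Qed.

Lemma substringP (i j i' j' : 'I_n) : i <= j -> i' <= j' ->
  substring S i j = substring S i' j' <-> j - i = j' - i' /\ same_word letter (j - i).+1 i i'.
Proof.
move=> ij ij'.
have sz (a b : 'I_n) : a <= b -> size (substring S a b) = (b - a).+1.
  by move=> ab; rewrite size_take size_drop size_tuple; have := ltn_ord b; case: ifP; nlia.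
have nt (a b : 'I_n) t : t < (b - a).+1 -> nth None (map Some (substring S a b)) t = letter (a + t).
  by move=> tb; rewrite map_take map_drop nth_take // nth_drop.
split=> [e|[e /mtP h]].
  have es : j - i = j' - i' by have := congr1 size e; rewrite !sz // => -[].
  by split=> //; apply/mtP => t tm; rewrite -(nt i j) // -(nt i' j') -?es // e.
have inj : injective (@Some T) by move=> ? ? [].
apply: (inj_map inj); apply: (@eq_from_nth _ None).
  by rewrite !size_map !sz // e.
move=> t; rewrite size_map sz // => tm.
by rewrite !nt ?h // -e.
Qed.

Lemma attractorP k (G : {set 'I_n}) : attractor k S G <-> att letter k G.
Proof.
split=> [h|/attP h].
  apply/attP => m y /andP [m0 mk] ym.
  have yn : y < n by nlia.
  have jn : y + m.-1 < n by nlia.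
  have [|i' [j' [e [g gG b]]]] := h (Ordinal yn) (Ordinal jn); first by rewrite /=; nlia.
  have [es hm] := (substringP (ltac:(nlia) : i' <= j') (leq_addr _ _ : Ordinal yn <= Ordinal jn)).1 e.
  rewrite /= addKn in es.
  have em : (j' - i').+1 = m by nlia.
  rewrite em mt_sym in hm.
  by apply/hitP; exists i', g; split=> //; nlia.
move=> i j b; have jn := ltn_ord j.
have /hitP [y' [g [gG hm gb]]] : hit letter G (j - i).+1 i by apply: h; nlia.
have inn := mt_in letter_None hm (ltn0Sn _) ltac:(nlia).
have yn : y' < n by nlia.
have jn' : y' + (j - i) < n by nlia.
exists (Ordinal yn), (Ordinal jn'); split; last by exists g => //=; nlia.
apply/substringP => /=; [nlia|nlia|].
by rewrite addKn mt_sym.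
Qed.
End Strings.

Theorem theorem31 (T : eqType) (n k : nat) (S : n.-tuple T)
    (G Gstar : {set 'I_n}) :
  1 <= k ->
  minimal_attractor k S G ->
  minimum_attractor k S Gstar ->
  #|G| <= k * #|Gstar|.
Proof.
move=> k0 [/attractorP aG minG] [/attractorP aGs _].
have mG : mini (letter S) k G.
  (* Supersets of attractors are attractors, so it is enough to remove single elements. *)
  apply/minsetP; split=> // B aB sB; apply/eqP; rewrite eqEsubset sB.
  apply/subsetP => g gG; apply/negPn/negP => gB; apply: (minG g gG); apply/attractorP.
  apply: att_sub aB; apply/subsetP => x xB; rewrite !inE (subsetP sB) // andbT.
  by apply: contraNneq gB => <-.
have lower := mini_le (letter_None S) k0 mG.
have upper := windows_le (letter_None S) k0 aGs.
by rewrite -(leq_add2r (recurring n (letter S) k)); apply: leq_trans lower upper.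
Qed.
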